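(* Let $a$ and $b$ be two free random variables with the same distribution in a non-commutative probability space, and denote $\lambda_n:=\kappa_n(a)=\kappa_n(b)$ for $n\ge1$. Then $$\kappa_n(ab+ba)=2\cdot\sum_{\pi\in\mathcal{X}_{2n}}\ \prod_{V\in\pi}\lambda_{|V|}\qquad\text{for all } n\ge 1.$$
   Context: A non-commutative probability space $(\mathcal{A},\varphi)$ is a unital algebra over $\mathbb{C}$ with a linear functional $\varphi$, $\varphi(1)=1$. The free cumulants are the multilinear functionals $\kappa_n:\mathcal{A}^n\to\mathbb{C}$ determined recursively by $\varphi(a_1\cdots a_n)=\sum_{\pi\in\mathcal{NC}(n)}\prod_{V\in\pi}\kappa_{|V|}(a_V)$, where for $V=\{v_1<\dots<v_k\}$, $\kappa_{|V|}(a_V)=\kappa_k(a_{v_1},\dots,a_{v_k})$; $\kappa_n(a):=\kappa_n(a,\dots,a)$. Freeness is free independence, equivalently vanishing of mixed free cumulants in $a,b$. ''Same distribution'' means $\varphi(a^n)=\varphi(b^n)$ for all $n\ge1$, equivalently $\kappa_n(a)=\kappa_n(b)$ for all $n\ge1$. $\mathcal{NC}(2n)$ is the set of non-crossing partitions of $\{1,\dots,2n\}$. For $\pi\in\mathcal{NC}(2n)$, the undirected graph $\mathcal{G}_\pi$ (loops and multiple edges allowed) has as vertices the blocks of $\pi$, and for each $k=1,\dots,n$ one edge joining the block containing $2k-1$ and the block containing $2k$. $\mathcal{X}_{2n}:=\{\pi\in\mathcal{NC}(2n): \mathcal{G}_\pi\text{ is connected and bipartite}\}$. *)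

(* Defs.v *)
From HB Require Import structures.
From mathcomp Require Import all_boot all_order all_algebra.
From mathcomp Require Import complex.
From mathcomp Require Import reals.

Set Implicit Arguments.
Unset Strict Implicit.
Unset Printing Implicit Defensive.

Import GRing.Theory.
Local Open Scope ring_scope.

Definition noncrossing (m : nat) (P : {set {set 'I_m}}) : bool :=
  [forall V in P, forall W in P, (V != W) ==>
     ~~ [exists i in V, exists j in W, exists k in V, exists l in W,
          [&& (i < j)%N, (j < k)%N & (k < l)%N]]].

Definition NC (m : nat) : {set {set {set 'I_m}}} :=
  [set P | partition P [set: 'I_m] && noncrossing P].

(* Finite undirected multigraphs, loops and multiple edges allowed. Only the
   unordered pair underlying [ends e] matters to the predicates below. *)

Record multigraph (T E : finType) := Multigraph {
  vertices : {set T};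
  ends : E -> T * T }.

Definition adjacent (T E : finType) (G : multigraph T E) : rel T :=
  fun u v => [exists e, (ends G e == (u, v)) || (ends G e == (v, u))].

Definition connected_graph (T E : finType) (G : multigraph T E) : bool :=
  (vertices G != set0) &&
  [forall u in vertices G, forall v in vertices G, connect (adjacent G) u v].

Definition bipartite_graph (T E : finType) (G : multigraph T E) : bool :=
  [exists X : {set T}, exists Y : {set T},
    [&& X :|: Y == vertices G, [disjoint X & Y] &
      [forall e, ((ends G e).1 \in X) && ((ends G e).2 \in Y)
              || ((ends G e).1 \in Y) && ((ends G e).2 \in X)]]].

(* With points numbered from 0, the pair {2k-1, 2k} for k = 1, ..., n becomes
   {2k, 2k+1} for k < n. *)

Lemma fst_point_subproof (n : nat) (k : 'I_n) : (2 * k < 2 * n)%N.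
Proof. by rewrite ltn_pmul2l. Qed.

Lemma snd_point_subproof (n : nat) (k : 'I_n) : ((2 * k).+1 < 2 * n)%N.
Proof. by have := ltn_ord k; rewrite -(@leq_pmul2l 2) // mulnS. Qed.

Definition fst_point (n : nat) (k : 'I_n) : 'I_(2 * n) :=
  Ordinal (fst_point_subproof k).

Definition snd_point (n : nat) (k : 'I_n) : 'I_(2 * n) :=
  Ordinal (snd_point_subproof k).

Definition pair_graph (n : nat) (P : {set {set 'I_(2 * n)}}) :
    multigraph {set 'I_(2 * n)} 'I_n :=
  {| vertices := P;
     ends := fun k => (pblock P (fst_point k), pblock P (snd_point k)) |}.

Definition X2 (n : nat) : {set {set {set 'I_(2 * n)}}} :=
  [set P in NC (2 * n) |
    connected_graph (pair_graph P) && bipartite_graph (pair_graph P)].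

Section FreeProbability.
Variables (C : fieldType) (A : algType C) (phi : {scalar A}).

(* For s = (a_1, ..., a_m) and V = {v_1 < ... < v_k}, this is
   (a_{v_1}, ..., a_{v_k}): [enum] lists ordinals in increasing order. *)
Definition subword (s : seq A) (V : {set 'I_(size s)}) : seq A :=
  [seq nth 0 s i | i : 'I_(size s) <- enum V].

(* The moment-cumulant formula solved for the term of the one-block partition;
   every other block is shorter than s, so [size s] steps of recursion
   suffice. [moment_cumulant] below is the defining property. *)
Fixpoint fcumulant_rec (fuel : nat) (s : seq A) : C :=
  if fuel is fuel'.+1 then
    phi (\prod_(x <- s) x) -
    \sum_(P in NC (size s) | P != [set [set: 'I_(size s)]])
      \prod_(V in P) fcumulant_rec fuel' (subword V)
  else 0.

(* kappa_m(a_1, ..., a_m), with m = size s *)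
Definition fcumulant (s : seq A) : C := fcumulant_rec (size s) s.

(* kappa_n(a) = kappa_n(a, ..., a) *)
Definition fcumulant1 (n : nat) (a : A) : C := fcumulant (nseq n a).

(* Free independence of the unital subalgebras generated by a and by b, whose
   elements are the values at a and at b of polynomials. A word is given by its
   letters (c, p), standing for p(a) if c = false and for p(b) if c = true. *)
Definition letter_val (a b : A) (u : bool * {poly C}) : A :=
  horner_alg (if u.1 then b else a) u.2.

Definition free_pair (a b : A) : Prop :=
  forall w : seq (bool * {poly C}),
    w != [::] ->
    sorted (fun u v => u.1 != v.1) w ->
    (forall u, u \in w -> phi (letter_val a b u) = 0) ->
    phi (\prod_(u <- w) letter_val a b u) = 0.

Definition same_distribution (a b : A) : Prop :=
  forall n : nat, (1 <= n)%N -> phi (a ^+ n) = phi (b ^+ n).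

Lemma size_subword (s : seq A) (V : {set 'I_(size s)}) :
  size (subword V) = #|V|.
Proof. by rewrite size_map -cardE. Qed.

Lemma subword_setT (s : seq A) : subword [set: 'I_(size s)] = s.
Proof.
rewrite /subword enum_setT -enumT -[in RHS](mkseq_nth 0 s) /mkseq.
by rewrite -val_enum_ord -map_comp.
Qed.

Lemma one_block_NC (m : nat) : (0 < m)%N -> [set [set: 'I_m]] \in NC m.
Proof.
move=> m_gt0; rewrite inE; apply/andP; split.
  apply/and3P; split; first by rewrite /cover big_set1.
    by apply/trivIsetP => V W /set1P-> /set1P->; rewrite eqxx.
  rewrite inE eq_sym; apply/set0Pn; exists (Ordinal m_gt0); exact: in_setT.
apply/forall_inP => V /set1P ->; apply/forall_inP => W /set1P ->.
by rewrite eqxx.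
Qed.

Lemma block_lt (m : nat) (P : {set {set 'I_m}}) (V : {set 'I_m}) :
  P \in NC m -> P != [set [set: 'I_m]] -> V \in P -> (#|V| < m)%N.
Proof.
rewrite inE => /andP[/and3P[_ tI n0] _] neP VP.
have leVm : (#|V| <= m)%N by have := max_card (mem V); rewrite card_ord.
rewrite ltn_neqAle leVm andbT.
apply: contraNneq neP => cV.
have VT : V = [set: 'I_m].
  by apply/eqP; rewrite eqEcard subsetT cardsT card_ord cV leqnn.
rewrite eqEsubset sub1set -VT VP andbT; apply/subsetP => W WP.
rewrite inE; apply: contraNT n0 => neVW.
have := trivIsetP tI _ _ WP VP neVW.
by rewrite VT -setI_eq0 setIT => /eqP <-.
Qed.

Lemma fcumulant_rec_enough (f g : nat) (s : seq A) :
  (size s <= f)%N -> (size s <= g)%N -> (0 < size s)%N ->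
  fcumulant_rec f s = fcumulant_rec g s.
Proof.
elim: f g s => [|f IH] [|g] s sf sg s0; do ?by move: (leq_trans s0 sf).
  by move: (leq_trans s0 sg).
rewrite /=; congr (_ - _); apply: eq_bigr => P /andP[PNC neP].
apply: eq_bigr => V VP.
have ltV := block_lt PNC neP VP.
apply: IH; rewrite size_subword.
- by rewrite -ltnS (leq_trans ltV).
- by rewrite -ltnS (leq_trans ltV).
rewrite card_gt0; move: PNC; rewrite inE => /andP[/and3P[_ _ n0] _].
by apply: contraNneq n0 => <-.
Qed.

Theorem moment_cumulant (s : seq A) : (0 < size s)%N ->
  phi (\prod_(x <- s) x) =
  \sum_(P in NC (size s)) \prod_(V in P) fcumulant (subword V).
Proof.
move=> s0; rewrite (bigD1 _ (one_block_NC s0)) /= big_set1 subword_setT.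
rewrite {1}/fcumulant (@fcumulant_rec_enough _ (size s).+1) //=.
rewrite -[LHS](subrK (\sum_(P in NC (size s) | P != [set [set: 'I_(size s)]])
  \prod_(V in P) fcumulant (subword V))).
congr (_ - _ + _); apply: eq_bigr => P /andP[PNC neP]; apply: eq_bigr => V VP.
apply: fcumulant_rec_enough; rewrite size_subword //.
  exact: ltnW (block_lt PNC neP VP).
rewrite card_gt0; move: PNC; rewrite inE => /andP[/and3P[_ _ n0] _].
by apply: contraNneq n0 => <-.
Qed.

Theorem moment_cumulant_unique (kappa : seq A -> C) :
  (forall s, (0 < size s)%N ->
    phi (\prod_(x <- s) x) =
    \sum_(P in NC (size s)) \prod_(V in P) kappa (subword V)) ->
  forall s, (0 < size s)%N -> kappa s = fcumulant s.
Proof.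
move=> Hk s; have [m] := ubnP (size s); elim: m s => // m IH s sm s0.
have := Hk s s0; rewrite (moment_cumulant s0).
rewrite !(bigD1 _ (one_block_NC s0)) /= !big_set1 !subword_setT.
suff -> : \sum_(P in NC (size s) | P != [set [set: 'I_(size s)]])
            \prod_(V in P) fcumulant (subword V) =
          \sum_(P in NC (size s) | P != [set [set: 'I_(size s)]])
            \prod_(V in P) kappa (subword V) by move/addIr.
apply: eq_bigr => P /andP[PNC neP]; apply: eq_bigr => V VP.
apply/esym/IH; rewrite size_subword.
  by rewrite (leq_trans (block_lt PNC neP VP)).
rewrite card_gt0; move: PNC; rewrite inE => /andP[/and3P[_ _ n0] _].
by apply: contraNneq n0 => <-.
Qed.

Lemma fcumulant1E (n : nat) (a : A) : (0 < n)%N ->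
  fcumulant1 n a = phi (a ^+ n) -
    \sum_(P in NC n | P != [set [set: 'I_n]]) \prod_(V in P) fcumulant1 #|V| a.
Proof.
move=> n0; pose F m : C := phi (a ^+ m) -
  \sum_(P in NC m | P != [set [set: 'I_m]]) \prod_(V in P) fcumulant1 #|V| a.
suff H s : (0 < size s)%N -> s = nseq (size s) a -> fcumulant s = F (size s).
  by rewrite /fcumulant1 (H (nseq n a)) ?size_nseq.
move=> s0 sE; have := moment_cumulant s0.
rewrite (bigD1 _ (one_block_NC s0)) /= big_set1 subword_setT => sumE.
have sI (i : 'I_(size s)) : nth 0 s i = a.
  by case: i => i /= lti; rewrite sE nth_nseq lti.
rewrite /F -(addrK (\sum_(P in NC (size s) | P != [set [set: 'I_(size s)]])
  \prod_(V in P) fcumulant (subword V)) (fcumulant s)) -sumE.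
congr (phi _ - _).
  rewrite (big_nth 0) big_mkord (eq_bigr (fun=> a)) => [|i _]; last exact: sI.
  by rewrite prodr_const card_ord.
apply: eq_bigr => P _; apply: eq_bigr => V _; congr fcumulant.
by rewrite /subword (eq_map sI) cardE; elim: (enum _) => //= i r ->.
Qed.

Theorem same_distribution_fcumulant1 (a b : A) : same_distribution a b ->
  forall n : nat, (1 <= n)%N -> fcumulant1 n a = fcumulant1 n b.
Proof.
move=> Hab n; have [m] := ubnP n; elim: m n => // m IH n nm n0.
rewrite !fcumulant1E // (Hab n n0); congr (_ - _).
apply: eq_bigr => P /andP[PNC neP]; apply: eq_bigr => V VP; apply: IH.
  by rewrite (leq_trans (block_lt PNC neP VP)).
rewrite card_gt0; move: PNC; rewrite inE => /andP[/and3P[_ _ n0'] _].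
by apply: contraNneq n0' => <-.
Qed.

End FreeProbability.

(* Main.v *)
Require Import Defs.
From mathcomp Require Import all_boot all_order all_algebra.
From mathcomp Require Import complex.
From mathcomp Require Import reals.

Import GRing.Theory.
Local Open Scope ring_scope.

(** The formula combines three facts on free cumulants with a count of graph
colourings.

Multilinearity writes [kappa_n (ab + ba)] as the sum, over the sets [T] of
slots, of the cumulant with entry [ba] in the slots of [T] and [ab] in the
others ([cumulant_expand]).  A cumulant whose [n] entries are products of two
factors is the sum over the noncrossing partitions of the [2n] factors whose
graph is connected ([cumulant_of_products]).  Freeness kills every term in
which some block contains both an [a] and a [b], and the surviving terms are
the products of the [lambda_|V|], whatever [T] is ([mixed_cumulants_vanish]).
After exchanging the two sums, a connected partition is counted once for each
[T] that makes all its blocks monochromatic.  Since the two factors of a slot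
are different letters, such a [T] is a proper 2-colouring of the graph: a
connected graph has two of them if it is bipartite and none otherwise
([card_monochromatic]).

Both structural facts are proved by comparing moments, because the
moment-cumulant formula determines the cumulants from the moments by induction
on the length.

For products, the slots of a noncrossing partition of the [2n] factors fall
into connected components.  The components form a noncrossing partition of the
slots, and the partitions with given components are obtained by choosing a
connected one inside each of them.  So the sum over all partitions factorises
([components_sum]), which is the moment-cumulant formula for the connected
sums.

For freeness, the sum over noncrossing partitions is computed by reading the
points from left to right, with a stack of the points whose block is not yet
complete ([stack_sum], [NCon_sumE]).  The moments of words in [a] and [b]
satisfy the same recursion once the stack is read as a product of polynomials
[appell j], one for each run of [j] equal letters on the stack: multiplying by
one more letter either lengthens the last run or completes a block.  When no
letter is left, freeness makes the moment of the stack vanish unless the stack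
is empty, because the polynomials are centred and the runs alternate; this is
the initial value of [stack_sum]. *)

Set Implicit Arguments.
Unset Strict Implicit.
Unset Printing Implicit Defensive.

(** * Noncrossing partitions of a set of ordinals *)

Lemma partition_intro (T : finType) (P : {set {set T}}) (D : {set T}) :
  (forall V, V \in P -> V != set0) -> (forall V, V \in P -> V \subset D) ->
  (forall x, x \in D -> exists2 V, V \in P & x \in V) ->
  (forall V W x, V \in P -> W \in P -> x \in V -> x \in W -> V = W) ->
  partition P D.
Proof.
move=> n0 sub ex un; apply/and3P; split.
- rewrite eqEsubset; apply/andP; split; first exact/bigcupsP.
  by apply/subsetP => x /ex[V VP xV]; apply/bigcupP; exists V.
- apply/trivIsetP => V W VP WP; apply: contraR => /pred0Pn[x /= /andP[xV xW]].
  by apply/eqP; apply: un xV xW.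
by apply/negP => /n0; rewrite eqxx.
Qed.

Lemma block_sub (T : finType) (P : {set {set T}}) (D V : {set T}) :
  partition P D -> V \in P -> V \subset D.
Proof. by move=> /cover_partition <- VP; apply: (bigcup_max V). Qed.

Lemma block_uniq (T : finType) (P : {set {set T}}) (D X Y : {set T}) x :
  partition P D -> X \in P -> Y \in P -> x \in X -> x \in Y -> X = Y.
Proof.
by case/and3P => _ tI _ XP YP xX xY; rewrite -(def_pblock tI XP xX) (def_pblock tI YP xY).
Qed.

Lemma partition_full_block (T : finType) (P : {set {set T}}) (D : {set T}) :
  partition P D -> D \in P -> P = [set D].
Proof.
move=> pP DP; apply/eqP; rewrite eqEsubset sub1set DP andbT.
apply/subsetP => W WP; rewrite inE; case/and3P: (pP) => _ tI n0.
apply: contraNT n0 => neDW; have := trivIsetP tI _ _ WP DP neDW.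
by rewrite -setI_eq0 (setIidPl (block_sub pP WP)) => /eqP <-.
Qed.

Section NCon.
Variable m : nat.
Implicit Types (D V W B : {set 'I_m}) (P : {set {set 'I_m}}).

Definition ord_lt : rel 'I_m := fun i j => (i < j)%N.

Lemma ord_lt_trans : transitive ord_lt.
Proof. by move=> j i k; apply: ltn_trans. Qed.

Lemma ord_lt_irr : irreflexive ord_lt.
Proof. by move=> i; apply: ltnn. Qed.

Lemma sorted_enum_ord D : sorted ord_lt (enum D).
Proof.
rewrite {1}/enum_mem; apply: sorted_filter; first exact: ord_lt_trans.
rewrite -enumT; have := iota_ltn_sorted 0 m.
by rewrite -val_enum_ord sorted_map.
Qed.

Lemma noncrossingP P :
  reflect (forall V W, V \in P -> W \in P -> forall i j k l : 'I_m,
             i \in V -> j \in W -> k \in V -> l \in W ->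
             (i < j)%N -> (j < k)%N -> (k < l)%N -> V = W)
          (noncrossing P).
Proof.
apply: (iffP forall_inP) => [nc V W VP WP i j k l iV jW kV lW ij jk kl|nc V VP].
  have /implyP := forall_inP (nc V VP) W WP; case: eqVneq => // _ /(_ isT) /negP[].
  apply/exists_inP; exists i => //; apply/exists_inP; exists j => //.
  apply/exists_inP; exists k => //; apply/exists_inP; exists l => //.
  exact/and3P.
apply/forall_inP => W WP; apply/implyP => neVW; apply/negP.
case/exists_inP => i iV /exists_inP[j jW /exists_inP[k kV /exists_inP[l lW]]].
case/and3P => ij jk kl; case/eqP: neVW.
exact: (nc V W VP WP i j k l).
Qed.

Definition NCon D : {set {set {set 'I_m}}} :=
  [set P | partition P D && noncrossing P].

Lemma NConP D P :
  P \in NCon D -> partition P D /\ noncrossing P.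
Proof. by rewrite inE => /andP[]. Qed.

Lemma NCon_set0 : NCon set0 = [set set0].
Proof.
apply/setP => P; rewrite !inE partition_set0; apply/andP/eqP => [[/eqP-> //]|->].
split=> //.
by apply/noncrossingP => V W; rewrite inE.
Qed.

Lemma noncrossingS P P' : P' \subset P -> noncrossing P -> noncrossing P'.
Proof.
move=> /subsetP sP /noncrossingP nc; apply/noncrossingP => V W /sP VP /sP WP.
exact: nc.
Qed.

(** When no other point of [D] lies between two points of [B], the block [B]
crosses nothing, and may be added to or removed from a noncrossing partition.
The second conjunct excludes that [B] is already a member of [P]. *)
Lemma NCon_setU1 D B P : B != set0 -> B \subset D ->
  (forall x y z : 'I_m, x \in B -> y \in D -> z \in B -> (x < y)%N -> (y < z)%N ->
     y \in B) ->
  (B |: P \in NCon D) && ((B |: P) :\ B == P) = (P \in NCon (D :\: B)).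
Proof.
move=> B0 sBD itv; rewrite !inE; apply/andP/andP => [[/andP[pP nc] /eqP PE]|[pP nc]].
  split; last by apply: noncrossingS nc; apply: subsetUr.
  by rewrite -PE; apply: partitionD1 => //; apply: setU11.
have BP : B \notin P.
  apply: contra B0 => BP; have := block_sub pP BP.
  by rewrite subsetD -setI_eq0 setIid => /andP[].
split; last by rewrite setU1K.
have sW W : W \in P -> forall x, x \in W -> (x \notin B) && (x \in D).
  move=> WP x xW; have /subsetP /(_ x xW) := block_sub pP WP.
  by rewrite inE.
apply/andP; split.
  have -> : D = B :|: (D :\: B) by rewrite -[LHS](setID D B) (setIidPr sBD).
  apply: partitionU1 => //; rewrite -setI_eq0 setIDA setIC.
  by rewrite -setIDA setDv setI0.
apply/noncrossingP => V W /setU1P VP /setU1P WP i j k l iV jW kV lW ij jk kl.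
case: VP WP => [VE|VP] [WE|WP]; subst=> //.
- have /andP[jB jD] := sW _ WP j jW.
  by rewrite (itv i j k) in jB.
- have /andP[kB kD] := sW _ VP k kV.
  by rewrite (itv j k l) in kB.
exact: (noncrossingP _ nc V W VP WP i j k l).
Qed.

Lemma NCon_one_block D : D != set0 -> [set D] \in NCon D.
Proof.
move=> D0; rewrite inE; apply/andP; split.
  apply/and3P; split; first by rewrite /cover big_set1.
    by apply/trivIsetP => V W /set1P-> /set1P->; rewrite eqxx.
  by rewrite inE eq_sym.
by apply/noncrossingP => V W /set1P-> /set1P->.
Qed.

Lemma NCon_block_neq0 D P V : P \in NCon D -> V \in P -> V != set0.
Proof.
rewrite inE => /andP[/and3P[_ _ n0] _] VP; by apply: contraNneq n0 => <-.
Qed.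

Lemma NCon_block_sub D P V : P \in NCon D -> V \in P -> V \subset D.
Proof. by rewrite inE => /andP[pP _]; apply: block_sub. Qed.

Lemma NCon_block_lt D P V : P \in NCon D -> P != [set D] -> V \in P ->
  (#|V| < #|D|)%N.
Proof.
move=> PN neP VP; apply: proper_card; rewrite properEneq (NCon_block_sub PN VP) andbT.
apply: contraNneq neP => VD; move: PN; rewrite inE => /andP[pP _].
by apply/eqP/partition_full_block => //; rewrite -VD.
Qed.

End NCon.

(** * Summing over noncrossing partitions with a stack *)

Section StackSum.
Variable C : comNzRingType.

(** The weight of the noncrossing partitions of a word, [K] being the weight
of a block. [s] is what remains to be read and [st] holds the points read so
far whose block is incomplete, the latest on top. The next point [i] either
is not the last one of its block, and goes on the stack, or completes a block;
by noncrossingness the other points of that block are then the top [k] of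
the stack. A letter may stand for a point, so the value depends on the word
only, not on the set of positions that carries it. *)
Fixpoint stack_sum (T : Type) (K : seq T -> C) (s st : seq T) : C :=
  if s is i :: s' then
    stack_sum K s' (i :: st) +
    \sum_(k < (size st).+1)
      K (rcons (rev (take k st)) i) * stack_sum K s' (drop k st)
  else (nilp st)%:R.

Lemma filter_take (T : eqType) (p : pred T) (st : seq T) :
  sorted (fun x y => p y ==> p x) st ->
  filter p st = take (count p st) st.
Proof.
elim: st => //= x st IH pst; have := path_sorted pst => /IH {}IH.
case: ifP => px; first by rewrite IH.
suff c0 : count p st = 0%N by rewrite IH c0 take0.
apply/eqP; rewrite -leqn0 leqNgt -has_count; apply/negP => /hasP[y yst py].
have tr : transitive (fun x y => p y ==> p x).
  by move=> b a c /implyP ab /implyP bc; apply/implyP => /bc /ab.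
by move: pst; rewrite (path_sortedE tr) => /andP[/allP /(_ y yst)]; rewrite py px.
Qed.

(** The partitions in which every block has its last point in [s] are the ways
of completing the state [(s, st)]. They are sorted according to whether the
first point [i] of [s] ends its block. If it does, that block is an interval
of the points still in play, so it can be removed by [NCon_setU1]. *)
Lemma stack_sumE m (kap : {set 'I_m} -> C) (s st : seq 'I_m) :
  sorted (@ord_lt m) (rev st ++ s) ->
  \sum_(P in NCon [set i in st ++ s] |
        [forall V in P, ~~ (V \subset [set i in st])]) \prod_(V in P) kap V =
  stack_sum (fun v => kap [set i in v]) s st.
Proof.
elim: s st => [|i s IH] st srt /=.
  case: st srt => [|x st] _.
    have -> : [set i : 'I_m in [::] ++ [::]] = set0 by apply/setP=> i; rewrite !inE.
    rewrite NCon_set0 (big_pred1 set0) ?big_set0 // => P; rewrite !inE.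
    case: eqP => // ->; apply/forall_inP => V; by rewrite inE.
  rewrite big_pred0 //= => P; apply/negP => /andP[PN /forall_inP sub].
  move: PN; rewrite inE cats0 => /andP[pP _].
  have cP : x \in cover P by rewrite (cover_partition pP) inE mem_head.
  have /negP[] := sub _ (pblock_mem cP).
  by apply: (block_sub pP); apply: pblock_mem.
have srt' : sorted (@ord_lt m) (rev (i :: st) ++ s) by rewrite rev_cons cat_rcons.
have Dp : [set x in st ++ i :: s] = [set x in (i :: st) ++ s].
  by apply/setP => x; rewrite !inE !mem_cat !inE orbCA.
have uq : uniq (st ++ i :: s).
  have := sorted_uniq (@ord_lt_trans m) (@ord_lt_irr m) srt.
  by rewrite (perm_uniq (_ : perm_eq _ (st ++ i :: s))) // perm_cat2r perm_rev.
have lt_st x : x \in st -> (x < i)%N.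
  move=> xst; move: srt; rewrite (sorted_pairwise (@ord_lt_trans m)) pairwise_cat.
  case/and3P => /allrelP /(_ x i) h _ _; apply: h; rewrite ?mem_rev ?mem_head //.
have lt_s x : x \in s -> (i < x)%N.
  move=> xs; move: srt; rewrite (sorted_pairwise (@ord_lt_trans m)) pairwise_cat.
  by case/and3P => _ _ /= /andP[/allP /(_ x xs)].
have uqs : uniq st by move: uq; rewrite cat_uniq => /and3P[].
(* the first sum keeps the partitions in which [i] does not end its block *)
rewrite (bigID (fun P : {set {set 'I_m}} =>
  [forall V in P, ~~ (V \subset [set x in i :: st])])) /=.
congr (_ + _).
  rewrite -(IH _ srt'); apply: eq_bigl => P; rewrite Dp.
  case: (P \in NCon _) => //=; apply: andb_idl => /forall_inP h.
  apply/forall_inP => V VP; apply: contra (h V VP) => /subset_trans; apply.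
  by apply/subsetP => x; rewrite !inE => ->; rewrite orbT.
(* in the others, [k] is the number of points that the block of [i] takes from
   the stack *)
rewrite (partition_big (fun P => inord #|pblock P i|.-1 : 'I_(size st).+1)
  xpredT) //=; apply: eq_bigr => k _.
set B := [set x in rcons (rev (take k st)) i].
have kst : (k <= size st)%N by rewrite -ltnS.
have BE x : (x \in B) = (x == i) || (x \in take k st).
  by rewrite inE mem_rcons inE mem_rev.
have iB : i \in B by rewrite BE eqxx.
have B0 : B != set0 by apply/set0Pn; exists i.
have sBD : B \subset [set x in st ++ i :: s].
  apply/subsetP => x; rewrite BE !inE mem_cat inE.
  by case/orP => [->|/mem_take ->]; rewrite ?orbT.
have ist : i \notin st by apply/negP => /lt_st; rewrite ltnn.
have lt_dt x y : x \in drop k st -> y \in take k st -> (x < y)%N.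
  move=> xd yt; move: srt; rewrite -{1}(cat_take_drop k st) rev_cat -catA.
  rewrite (sorted_pairwise (@ord_lt_trans m)) pairwise_cat => /andP[/allrelP h _].
  by apply: h; rewrite ?mem_cat mem_rev ?yt.
have memst x : (x \in st) = (x \in take k st) || (x \in drop k st).
  by rewrite -mem_cat cat_take_drop.
have cardB c : (c <= size st)%N -> #|[set x in rcons (rev (take c st)) i]| = c.+1.
  move=> cst.
  rewrite cardsE; have /card_uniqP -> : uniq (rcons (rev (take c st)) i).
    rewrite rcons_uniq mem_rev rev_uniq take_uniq // andbT.
    by apply: contra ist => /mem_take.
  by rewrite size_rcons size_rev size_takel.
have DB : [set x in st ++ i :: s] :\: B = [set x in drop k st ++ s].
  apply/setP => x; rewrite !inE !mem_cat !inE mem_rcons inE mem_rev.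
  have [->|xi] /= := eqVneq x i.
    apply/esym/negP => /orP[/mem_drop|/lt_s]; [exact/negP | by rewrite ltnn].
  rewrite memst.
  have [xt|//] /= := boolP (x \in take k st).
  apply/esym/negP => /orP[/lt_dt /(_ xt)|/lt_s ix]; first by rewrite ltnn.
  by have := ltn_trans ix (lt_st _ (mem_take xt)); rewrite ltnn.
have itv (x y z : 'I_m) : x \in B -> y \in [set x in st ++ i :: s] -> z \in B ->
    (x < y)%N -> (y < z)%N -> y \in B.
  move=> xB yD zB xy yz; have yi : (y < i)%N.
    move: zB yz; rewrite BE => /orP[/eqP-> //|/mem_take /lt_st zi yz].
    exact: ltn_trans yz zi.
  rewrite BE; move: yD; rewrite inE mem_cat inE; case: eqVneq => //= _.
  case/orP => [|/lt_s iy]; last by have := ltn_trans iy yi; rewrite ltnn.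
  rewrite memst => /orP[-> //|yd].
  move: xB; rewrite BE => /orP[/eqP xi|xt].
    by have := ltn_trans xy yi; rewrite xi ltnn.
  by have := ltn_trans xy (lt_dt _ _ yd xt); rewrite ltnn.
(* the block ended by [i] takes a top segment of the stack *)
have closes P : P \in NCon [set x in st ++ i :: s] ->
    [forall V in P, ~~ (V \subset [set x in st])] ->
    ~~ [forall V in P, ~~ (V \subset [set x in i :: st])] ->
    inord #|pblock P i|.-1 == k -> B \in P.
  move=> PN /forall_inP Qst /forall_inPn[V VP /negPn Vsub] /eqP kE.
  move: PN; rewrite inE => /andP[pP /noncrossingP nc].
  have tI : trivIset P by case/and3P: pP.
  have iV : i \in V.
    apply: contraR (Qst V VP) => iV; apply/subsetP => x xV.
    have := subsetP Vsub x xV; rewrite !inE => /orP[/eqP xi|//].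
    by rewrite -xi xV in iV.
  have VE : pblock P i = V by apply: def_pblock.
  (* if it took [y] and left [x] above it, the block of [x] would end at some
     [z] after [i], and [y < x < i < z] would be a crossing *)
  have prefix_V : {in st &, forall x y, ord_lt y x -> (y \in V) ==> (x \in V)}.
    move=> x y xst yst yx; apply/implyP => yV; apply: contraT => xV.
    have xP : x \in cover P by rewrite (cover_partition pP) inE mem_cat xst.
    have /subsetPn[z zW] := Qst _ (pblock_mem xP); rewrite inE => zst.
    have zD := subsetP (block_sub pP (pblock_mem xP)) z zW.
    have zi : z != i.
      apply: contra xV => /eqP zi; rewrite -VE.
      by rewrite (def_pblock tI (pblock_mem xP)) -?zi // mem_pblock.
    move: zD; rewrite inE mem_cat inE (negPf zst) (negPf zi) /= => /lt_s iz.
    move: xP xV; rewrite -mem_pblock => xP.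
    rewrite (nc V (pblock P x) VP _ y x i z) ?xP ?pblock_mem -?mem_pblock //.
    exact: lt_st.
  have Vst : filter (mem V) st = take (count (mem V) st) st.
    apply: filter_take; apply: (sub_in_sorted prefix_V); first exact/allP.
    rewrite -rev_sorted; move: srt.
    rewrite !(sorted_pairwise (@ord_lt_trans m)) pairwise_cat.
    by case/and3P.
  have cst : (count (mem V) st <= size st)%N by apply: count_size.
  have VB : V = [set x in rcons (rev (take (count (mem V) st) st)) i].
    apply/setP => x; rewrite -Vst inE mem_rcons inE mem_rev mem_filter /=.
    have [->|xi] /= := eqVneq x i; first by [].
    case xV: (x \in V) => //=; have := subsetP Vsub x xV.
    by rewrite !inE (negPf xi).
  move: kE; rewrite VE {1}VB cardB // => /(congr1 val); rewrite /= inordK ?ltnS //.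
  by move=> kE; rewrite /B -kE -VB.
rewrite (reindex_onto (fun P => B |: P) (fun P => P :\ B)) => [|P]; last first.
  by move=> /andP[/andP[/andP[PN Q1] Q2] kE]; apply: setD1K; apply: closes.
have srtd : sorted (@ord_lt m) (rev (drop k st) ++ s).
  apply: (subseq_sorted (@ord_lt_trans m)) srt.
  apply: cat_subseq; last exact: subseq_cons.
  by rewrite -[X in subseq _ (rev X)](cat_take_drop k st) rev_cat prefix_subseq.
rewrite -(IH _ srtd) big_distrr /=; apply: eq_big => [P|P]; last first.
  case/andP => /andP[/andP[/andP[PN _] _] _] PE.
  rewrite big_setU1 //; by rewrite -(eqP PE) setD11.
rewrite -DB -(NCon_setU1 P B0 sBD itv).
have tBP : B |: P \in NCon [set x in st ++ i :: s] -> pblock (B |: P) i = B.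
  by rewrite inE => /andP[/and3P[_ tI _] _]; apply: def_pblock => //; apply: setU11.
have kB : inord #|B|.-1 == k by rewrite cardB // inord_val.
apply/andP/andP => [[/andP[/andP[/andP[PN Q1] _] _] PE]|[/andP[PN PE] Qd]].
  rewrite PN PE; split=> //; apply/forall_inP => V VP.
  apply: contra (forall_inP Q1 V (setU1r _ VP)) => /subset_trans; apply.
  by apply/subsetP => x; rewrite !inE => /mem_drop.
rewrite PN PE tBP // kB !andbT; split=> //; apply/andP; split.
  apply/forall_inP => V /setU1P[->|VP].
    by apply/subsetPn; exists i => //; rewrite inE.
  apply: contra (forall_inP Qd V VP) => /subsetP Vst; apply/subsetP => x xV.
  have := NCon_setU1 P B0 sBD itv; rewrite PN PE => /esym; rewrite inE => /andP[pP _].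
  have := subsetP (block_sub pP VP) x xV; rewrite inE BE => /andP[].
  have := Vst x xV; rewrite !inE memst.
  by case: (x \in take k st); rewrite ?orbT.
apply/forall_inPn; exists B; first exact: setU11.
apply/negPn/subsetP => x; rewrite BE !inE => /orP[->//|/mem_take ->].
by rewrite orbT.
Qed.

End StackSum.

Section StackSumTheory.
Variable C : comNzRingType.

Lemma stack_sum_map (T U : Type) (f : T -> U) (K : seq U -> C) s st :
  stack_sum (fun v => K (map f v)) s st = stack_sum K (map f s) (map f st).
Proof.
elim: s st => [|i s IH] st /=; first by case: st.
rewrite IH size_map; congr (_ + _); apply: eq_bigr => k _.
by rewrite IH map_rcons map_rev map_take map_drop.
Qed.

(** Blocks are read in order, so only the weights of subwords matter. *)
Lemma eq_stack_sum (T : eqType) (K1 K2 : seq T -> C) s st :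
  (forall v, v != [::] -> subseq v (rev st ++ s) -> K1 v = K2 v) ->
  stack_sum K1 s st = stack_sum K2 s st.
Proof.
elim: s st => [//|i s IH] st eqK /=; congr (_ + _).
  by apply: IH => v v0; rewrite rev_cons cat_rcons; apply: eqK.
apply: eq_bigr => k _; congr (_ * _).
  apply: eqK; first by rewrite -size_eq0 size_rcons.
  rewrite -[X in subseq _ (rev X ++ _)](cat_take_drop k st) rev_cat -catA.
  rewrite -cats1; apply: subseq_trans (suffix_subseq _ _).
  by rewrite cat_subseq //= eqxx sub0seq.
apply: IH => v v0 sv; apply: eqK => //; apply: subseq_trans sv _.
apply: cat_subseq; last exact: subseq_cons.
by rewrite -[X in subseq _ (rev X)](cat_take_drop k st) rev_cat prefix_subseq.
Qed.

(** The partition with a single block is the only one with a block as long as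
the whole word. *)
Lemma stack_sum_diff (T : Type) (K1 K2 : seq T -> C) s st :
  (forall v, (0 < size v < size st + size s)%N -> K1 v = K2 v) ->
  (0 < size s)%N ->
  stack_sum K1 s st - stack_sum K2 s st = K1 (rev st ++ s) - K2 (rev st ++ s).
Proof.
elim: s st => [//|i s IH] st eqK _ /=.
case: s IH eqK => [_ _|j s IH eqK].
  have E K : \sum_(k < (size st).+1) K (rcons (rev (take k st)) i) *
      stack_sum K [::] (drop k st) = K (rev st ++ [:: i]) :> C.
    rewrite big_ord_recr /= big1 ?add0r => [|k _]; last first.
      by rewrite /nilp size_drop subn_eq0 leqNgt ltn_ord mulr0.
    by rewrite take_size drop_size mulr1 cats1.
  by rewrite /= !add0r !E.
rewrite opprD addrACA IH //; last first.
  by move=> v; rewrite [(size (i :: st) + _)%N]addSnnS; apply: eqK.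
rewrite rev_cons cat_rcons -sumrB big1 ?addr0 // => k _.
have kst : (k <= size st)%N by rewrite -ltnS.
rewrite (eqK (rcons _ _)); last first.
  rewrite size_rcons size_rev size_takel //=.
  by rewrite addnS ltnS addnS ltnS (leq_trans kst) // leq_addr.
rewrite -mulrBr IH ?mulr_sumr //; last first.
  move=> v /andP[v0 sv]; apply: eqK; rewrite v0 (leq_trans sv) //.
  by rewrite size_drop leq_add // leq_subr.
rewrite eqK ?subrr ?mulr0 //.
rewrite size_cat size_rev size_drop /= addnS /= [X in (_ < X)%N]addnS ltnS.
by rewrite -addnS leq_add // leq_subr.
Qed.

(** Weights are determined by the sums over noncrossing partitions: this is
the uniqueness of free cumulants, for words over any alphabet. *)
Lemma stack_sum_inj (T : Type) (K1 K2 : seq T -> C) :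
  (forall s, (0 < size s)%N -> stack_sum K1 s [::] = stack_sum K2 s [::]) ->
  forall s, (0 < size s)%N -> K1 s = K2 s.
Proof.
move=> eqZ s; have [n] := ubnP (size s); elim: n s => // n IH s sn s0.
apply/eqP; rewrite -subr_eq0 -[s]/(rev [::] ++ s) -stack_sum_diff //.
  by rewrite eqZ // subrr.
by move=> v /andP[v0 vs]; apply: IH => //; apply: leq_trans vs _.
Qed.

Lemma NCon_sumE m (T : Type) (f : 'I_m -> T) (K : seq T -> C) (D : {set 'I_m}) :
  \sum_(P in NCon D) \prod_(V in P) K (map f (enum V)) =
  stack_sum K (map f (enum D)) [::].
Proof.
rewrite -[[::]]/(map f [::]) -stack_sum_map.
transitivity (stack_sum (fun v => K (map f (enum [set i in v]))) (enum D) [::]).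
  rewrite -(@stack_sumE _ _ (fun V => K (map f (enum V)))); last exact: sorted_enum_ord.
  have -> : [set i in [::] ++ enum D] = D by apply/setP => i; rewrite inE mem_enum.
  apply: eq_bigl => P; case PN: (P \in NCon D) => //=; apply/esym/forall_inP => V VP.
  have -> : [set i : 'I_m in [::]] = set0 by apply/setP => i; rewrite !inE.
  rewrite subset0; move: PN; rewrite inE => /andP[/and3P[_ _ n0] _].
  by apply: contraNneq n0 => <-.
apply: eq_stack_sum => v v0 /= sv; congr (K (map f _)).
apply: (irr_sorted_eq (@ord_lt_trans m) (@ord_lt_irr m)).
- exact: sorted_enum_ord.
- by apply: (subseq_sorted (@ord_lt_trans m) sv); apply: sorted_enum_ord.
by move=> i; rewrite mem_enum inE.
Qed.

End StackSumTheory.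

(** * Moments and cumulants indexed by a set of positions *)

Section MomentCumulant.
Variables (C : fieldType) (A : algType C) (phi : {scalar A}).

Lemma moment_stack_sum (s : seq A) : (0 < size s)%N ->
  phi (\prod_(x <- s) x) = stack_sum (fcumulant phi) s [::].
Proof.
move=> s0; rewrite (moment_cumulant phi s0) -[X in stack_sum _ X _](subword_setT s).
exact: NCon_sumE.
Qed.

(** A subset [D] of the positions can serve as index set of a word, with blocks
in the same ambient type, because [stack_sum] forgets the positions. *)
Lemma moment_cumulant_on m (f : 'I_m -> A) (D : {set 'I_m}) : D != set0 ->
  phi (\prod_(i <- enum D) f i) =
  \sum_(P in NCon D) \prod_(V in P) fcumulant phi (map f (enum V)).
Proof.
move=> D0; rewrite NCon_sumE -moment_stack_sum ?big_map //.
by rewrite size_map -cardE card_gt0.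
Qed.

End MomentCumulant.

(** * Mixed cumulants of free variables *)

Section Appell.
Variables (C : comNzRingType) (lam : nat -> C).

(** The joint cumulants of two free variables with cumulants [lam], on words in
these variables. *)
Definition mono_cumulant (v : seq bool) : C :=
  if constant v then lam (size v) else 0.

(** The list of the polynomials of degrees [j, ..., 0]: each of them is computed
from all the earlier ones. *)
Fixpoint appell_seq (j : nat) : seq {poly C} :=
  if j is j'.+1 then
    ((appell_seq j')`_0 * 'X - \sum_(k < j'.+1) lam k.+1 *: (appell_seq j')`_k)
      :: appell_seq j'
  else [:: 1].

(** The free Appell polynomials of a variable with cumulants [lam]. *)
Definition appell (j : nat) : {poly C} := (appell_seq j)`_0.

Lemma appell_seq_nth j k : (k <= j)%N -> (appell_seq j)`_k = appell (j - k).
Proof.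
elim: j k => [|j IH] [|k] // kj; by rewrite subSS -IH.
Qed.

(** The recursion of [stack_sum] for a stack of [j] equal letters: one more
letter is put on the stack, or ends a block together with [k] of them. *)
Lemma appellS j :
  appell j * 'X = appell j.+1 + \sum_(k < j.+1) lam k.+1 *: appell (j - k).
Proof.
have -> : \sum_(k < j.+1) lam k.+1 *: appell (j - k) =
          \sum_(k < j.+1) lam k.+1 *: (appell_seq j)`_k.
  by apply: eq_bigr => k _; rewrite appell_seq_nth // -ltnS.
by rewrite [appell j.+1]/appell /= subrK.
Qed.

Lemma mono_cumulant_nseq n c : mono_cumulant (nseq n c) = lam n.
Proof. by rewrite /mono_cumulant constant_nseq size_nseq. Qed.

Lemma mono_cumulant_mixed c d (v : seq bool) :
  c \in v -> d \in v -> c != d -> mono_cumulant v = 0.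
Proof.
rewrite /mono_cumulant; case: v => //= x v; case: allP => //= h.
have hx e : e \in x :: v -> e = x by rewrite inE => /orP[/eqP //|/h /eqP].
by move=> /hx -> /hx ->; rewrite eqxx.
Qed.

(** A stack of letters given by its maximal runs [(c, j)], from the top. *)
Definition runs_word (r : seq (bool * nat)) : seq bool :=
  flatten [seq nseq p.2 p.1 | p <- r].

(** The runs can lie below a possibly empty run of the letter [c]. *)
Definition runs_after (c : bool) (r : seq (bool * nat)) : bool :=
  path (fun d e => d != e) c (unzip1 r) && all (fun p => 0 < p.2)%N r.

(** Only the top run can be used to complete a block, since the weight of a
block with both letters vanishes. *)
Lemma stack_sum_run c s j r : runs_after c r ->
  stack_sum mono_cumulant (c :: s) (nseq j c ++ runs_word r) =
  stack_sum mono_cumulant s (nseq j.+1 c ++ runs_word r) +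
  \sum_(k < j.+1) lam k.+1 *
    stack_sum mono_cumulant s (nseq (j - k) c ++ runs_word r).
Proof.
move=> rok /=; congr (_ + _).
have leS : (j.+1 <= (size (nseq j c ++ runs_word r)).+1)%N.
  by rewrite ltnS size_cat size_nseq leq_addr.
rewrite (big_ord_widen _ (fun k => lam k.+1 *
  stack_sum mono_cumulant s (nseq (j - k) c ++ runs_word r)) leS).
rewrite [in RHS]big_mkcond; apply: eq_bigr => -[k /= kS] _.
rewrite ltnS; case: leqP => [kj|jk].
  rewrite take_cat drop_cat size_nseq.
  have T1 : (if (k < j)%N then take k (nseq j c)
      else nseq j c ++ take (k - j) (runs_word r)) = nseq k c.
    case: ltnP => [|jk]; first by rewrite take_nseq // => /ltnW.
    have -> : k = j by apply/eqP; rewrite eqn_leq kj.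
    by rewrite subnn take0 cats0.
  have T2 : (if (k < j)%N then drop k (nseq j c) ++ runs_word r
      else drop (k - j) (runs_word r)) = nseq (j - k) c ++ runs_word r.
    case: ltnP => [_|jk]; first by rewrite drop_nseq.
    have -> : k = j by apply/eqP; rewrite eqn_leq kj.
    by rewrite subnn drop0.
  rewrite T1 T2 rev_nseq -(mono_cumulant_nseq k.+1 c).
  by congr (mono_cumulant _ * _); rewrite -cats1 -[[:: c]]/(nseq 1 c) -nseqD addn1.
rewrite (@mono_cumulant_mixed c (~~ c)) ?mul0r ?mem_rcons ?mem_head //; last first.
  by case: (c).
rewrite inE mem_rev; apply/orP; right.
rewrite take_cat size_nseq ltnNge (ltnW jk) /= mem_cat; apply/orP; right.
move: kS; rewrite size_cat size_nseq ltnS.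
case: r rok {leS} => [_|[d i] r] /=; first by rewrite addn0 leqNgt jk.
case/andP=> /andP[/= cd _] /andP[i0 _] _.
have -> : ~~ c = d by case: (c) (d) cd => [] [].
rewrite -subn_gt0 in jk; case: (k - j)%N jk => // t _.
by case: i i0 => // i _; rewrite /runs_word /= mem_head.
Qed.

End Appell.

Section MixedCumulants.
Variables (C : fieldType) (A : algType C) (phi : {scalar A}).
Hypothesis phi1 : phi 1 = 1.
Variables a b : A.
Hypothesis free_ab : free_pair phi a b.
Hypothesis same_ab : same_distribution phi a b.

Let lam n := fcumulant1 phi n a.

Definition letter (c : bool) : A := if c then b else a.

Let y c j : A := horner_alg (letter c) (appell lam j).

Lemma fcumulant_letter n c : (0 < n)%N ->
  fcumulant phi (nseq n (letter c)) = lam n.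
Proof.
by case: c => //= n0; rewrite /lam (same_distribution_fcumulant1 same_ab).
Qed.

Let yS c j :
  y c j * letter c = y c j.+1 + \sum_(k < j.+1) lam k.+1 *: y c (j - k).
Proof.
rewrite /y -{2}(horner_algX (letter c)) -rmorphM /= appellS rmorphD /=.
congr (_ + _); rewrite rmorph_sum; apply: eq_bigr => k _ /=.
by rewrite linearZ; apply: mulr_algl.
Qed.

Let y0 c : y c 0 = 1. Proof. exact: rmorph1. Qed.

Lemma moment_letter_power n c :
  phi (letter c ^+ n) = stack_sum (mono_cumulant lam) (nseq n c) [::].
Proof.
case: n => [|n]; first by rewrite expr0 phi1.
have -> : letter c ^+ n.+1 = \prod_(x <- map letter (nseq n.+1 c)) x.
  rewrite map_nseq; elim: n.+1 => [|k IH]; first by rewrite big_nil.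
  by rewrite exprS IH big_cons.
rewrite moment_stack_sum ?size_map ?size_nseq // -[[::]]/(map letter [::]).
rewrite -stack_sum_map; apply: eq_stack_sum => v v0 sv.
have vE : v = nseq (size v) c.
  apply/all_pred1P/allP => d /(mem_subseq sv).
  by rewrite -[rev [::] ++ _]/(nseq n.+1 c) mem_nseq => /andP[].
rewrite vE map_nseq mono_cumulant_nseq fcumulant_letter //.
by rewrite lt0n size_eq0.
Qed.

(** Both sides satisfy the same recursion, which expresses the value at
[(n, j.+1)] by the values at smaller [j]; so the case [j = 0], which is the
moment-cumulant formula in one variable, propagates. *)
Let moment_appell j n c : phi (y c j * letter c ^+ n) =
  stack_sum (mono_cumulant lam) (nseq n c) (nseq j c).
Proof.
have [m] := ubnP j; elim: m j n => // m IH [|j] n jm.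
  by rewrite y0 mul1r moment_letter_power.
have := IH j n.+1 jm; rewrite exprS mulrA yS mulrDl linearD /=.
have := @stack_sum_run _ lam c (nseq n c) j [::] isT.
rewrite /runs_word /= !cats0 => ->.
suff -> : phi ((\sum_(k < j.+1) lam k.+1 *: y c (j - k)) * letter c ^+ n) =
  \sum_(k < j.+1) lam k.+1 *
    stack_sum (mono_cumulant lam) (nseq n c) (nseq (j - k) c ++ [::]).
  by move/addIr.
rewrite mulr_suml linear_sum; apply: eq_bigr => k _ /=.
rewrite -scalerAl linearZ /= IH ?cats0 //.
by apply: leq_ltn_trans (leq_subr _ _) _; rewrite -ltnS.
Qed.

(** The case [n = 0] of [moment_appell]: no letter is left to empty the
stack. *)
Lemma appell_centered j c : (0 < j)%N ->
  phi (horner_alg (letter c) (appell lam j)) = 0.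
Proof. by move=> j0; have := moment_appell j 0 c; rewrite mulr1 => ->; case: j j0. Qed.

(** The stack as an element of the algebra; its bottom is the leftmost factor,
so that the next letter multiplies the top run. *)
Let yprod r : A := \prod_(p <- rev r) y p.1 p.2.

Let yprod_cons c j r : yprod ((c, j) :: r) = yprod r * y c j.
Proof. by rewrite /yprod rev_cons -cats1 big_cat big_seq1. Qed.

(** This is where freeness enters: the runs alternate and each factor is
centred. *)
Let phi_yprod c r : runs_after c r -> phi (yprod r) = (nilp (runs_word r))%:R.
Proof.
case: r => [|p r]; first by rewrite /yprod big_nil phi1.
move=> /andP[/path_sorted srt /allP pos].
have -> : nilp (runs_word (p :: r)) = false.
  have := pos p (mem_head _ _); case: p {srt pos} => d i /=.
  by rewrite /nilp /runs_word /= size_cat size_nseq; case: i.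
pose w := [seq (u.1, appell lam u.2) | u <- rev (p :: r)].
have -> : yprod (p :: r) = \prod_(u <- w) letter_val a b u by rewrite big_map.
apply: free_ab.
- by rewrite -size_eq0 size_map size_rev.
- rewrite sorted_map rev_sorted; move: srt; rewrite sorted_map.
  apply: sub_sorted => u v /=.
  by rewrite eq_sym.
by move=> u /mapP[v]; rewrite mem_rev => /pos v0 ->; apply: appell_centered.
Qed.

(** Moments follow the recursion of [stack_sum], by [appellS] on the top
run. *)
Let phi_yprod_word s c j r : runs_after c r ->
  phi (yprod r * y c j * \prod_(d <- s) letter d) =
  stack_sum (mono_cumulant lam) s (nseq j c ++ runs_word r).
Proof.
elim: s c j r => [|d s IH] c j r rok.
  rewrite big_nil mulr1 /=; case: j => [|j].
    by rewrite y0 mulr1; apply: phi_yprod rok.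
  rewrite -yprod_cons -[nseq j.+1 c ++ _]/(runs_word ((c, j.+1) :: r)).
  apply: (@phi_yprod (~~ c)); move: rok; rewrite /runs_after /=.
  by case/andP => -> ->; case: (c).
(* the top run may be taken to be made of the next letter [d]: otherwise
   put an empty run of [d] on top, or uncover the run below an empty one *)
wlog dc : c j r rok / d = c => [wl|].
  have [|/eqP dc] := d =P c; first exact: wl.
  case: j => [|j].
    case: r rok => [|[e i] r] rok; first by have := wl d 0%N [::] isT erefl; rewrite !y0.
    have eE : d = e by case/andP: rok => /= /andP[]; case: (c) (d) (e) dc => [] [] [].
    rewrite y0 mulr1 yprod_cons; apply: (wl e i r) => //.
    by case/andP: rok => /= /andP[_ er] /andP[_ ri]; rewrite /runs_after er.
  have := wl d 0%N ((c, j.+1) :: r); rewrite y0 mulr1 yprod_cons; apply=> //.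
  by case/andP: rok => /= cr ri; rewrite /runs_after /= dc cr.
subst d; rewrite stack_sum_run // big_cons mulrA -[_ * y c j * _]mulrA yS.
rewrite mulrDr mulrDl linearD /= IH //; congr (_ + _).
rewrite mulr_sumr mulr_suml linear_sum; apply: eq_bigr => k _ /=.
by rewrite -scalerAr -scalerAl linearZ /= IH.
Qed.

Lemma moment_word s : phi (\prod_(d <- s) letter d) =
  stack_sum (mono_cumulant lam) s [::].
Proof.
have := @phi_yprod_word s false 0 [::] isT.
by rewrite /yprod big_nil y0 !mul1r.
Qed.

Theorem mixed_cumulants_vanish (v : seq bool) : (0 < size v)%N ->
  fcumulant phi (map letter v) = mono_cumulant lam v.
Proof.
apply: (stack_sum_inj (K1 := fun v => fcumulant phi (map letter v))) => s s0.
rewrite -moment_word stack_sum_map -moment_stack_sum ?size_map //.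
by rewrite big_map.
Qed.

End MixedCumulants.

(** * Multilinearity of cumulants *)

Section Additivity.
Variables (C : fieldType) (A : algType C) (phi : {scalar A}).
Variable m : nat.
Implicit Types (f g h : 'I_m -> A) (D S T : {set 'I_m}).

Lemma cumulant_onE f D : D != set0 ->
  fcumulant phi (map f (enum D)) = phi (\prod_(i <- enum D) f i) -
    \sum_(P in NCon D | P != [set D])
      \prod_(V in P) fcumulant phi (map f (enum V)).
Proof.
move=> D0; rewrite moment_cumulant_on // (bigD1 _ (NCon_one_block D0)) /=.
by rewrite big_set1 addrK.
Qed.

(** The moment is additive in slot [i], and in a partition with several blocks
only the block containing [i] changes; that block is shorter than the word. *)
Lemma cumulant_additive D i f g h : i \in D ->
  (forall j, j != i -> f j = h j) -> (forall j, j != i -> g j = h j) ->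
  h i = f i + g i ->
  fcumulant phi (map h (enum D)) =
  fcumulant phi (map f (enum D)) + fcumulant phi (map g (enum D)).
Proof.
move=> iD fh gh hi; have [n] := ubnP #|D|; elim: n D iD => // n IH D iD Dn.
have D0 : D != set0 by apply/set0Pn; exists i.
rewrite !cumulant_onE // addrACA -opprD; congr (_ - _).
  have := enum_uniq D; have : i \in enum D by rewrite mem_enum.
  case/splitPr => s1 s2; rewrite cat_uniq /= => /and4P[_ /norP[i1 _] i2 _].
  have off s : i \notin s -> \prod_(j <- s) f j = \prod_(j <- s) h j /\
      \prod_(j <- s) g j = \prod_(j <- s) h j.
    move=> is_; split; apply: eq_big_seq => j js; [apply: fh|apply: gh];
    by apply: contraNneq is_ => <-.
  rewrite !big_cat !big_cons /= !(proj1 (off _ i1)) !(proj2 (off _ i1)).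
  rewrite !(proj1 (off _ i2)) !(proj2 (off _ i2)) hi.
  by rewrite mulrDl mulrDr linearD.
rewrite -big_split; apply: eq_bigr => P /andP[PN neP] /=.
have iP : i \in cover P.
  by move: PN; rewrite inE => /andP[/cover_partition -> _].
have VP := pblock_mem iP.
rewrite !(bigD1 (pblock P i) VP) /= IH ?mem_pblock //; last first.
  by rewrite -ltnS; apply: leq_trans (NCon_block_lt PN neP VP) _; rewrite -ltnS.
have tI : trivIset P by move: PN; rewrite inE => /andP[/and3P[]].
have off k W : (forall j, j != i -> k j = h j) -> W \in P -> W != pblock P i ->
    map k (enum W) = map h (enum W).
  move=> kh WP neW; apply/eq_in_map => j; rewrite mem_enum => jW.
  apply: kh; apply: contraNneq neW => ji.
  by rewrite (def_pblock tI WP) // -ji.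
rewrite mulrDl; congr (_ * _ + _ * _); apply: eq_bigr => W /andP[WP neW].
  by rewrite (off f).
by rewrite (off g).
Qed.

End Additivity.

Section Expansion.
Variables (m : nat) (A C : zmodType) (F : ('I_m -> A) -> C).
Implicit Types (f g h : 'I_m -> A) (S T : {set 'I_m}).
Hypothesis eqF : forall f g, f =1 g -> F f = F g.
Hypothesis addF : forall i f g h,
  (forall j, j != i -> f j = h j) -> (forall j, j != i -> g j = h j) ->
  h i = f i + g i -> F h = F f + F g.

(** A function additive in every slot expands over the choices of one summand
in each slot of [S]; the slots outside [S] hold [g], which is what the
induction on [S] needs. *)
Lemma expand_slots S f0 f1 g :
  F (fun i => if i \in S then f0 i + f1 i else g i) =
  \sum_(T : {set 'I_m} | T \subset S)
     F (fun i => if i \in S then (if i \in T then f1 i else f0 i) else g i).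
Proof.
have [n] := ubnP #|S|; elim: n S g => // n IH S g Sn.
have [->|[i iS]] := set_0Vmem S.
  rewrite (big_pred1 set0) => [|T]; last by rewrite subset0.
  by apply: eqF => i; rewrite inE.
have S'n : (#|S :\ i| < n)%N by move: Sn; rewrite (cardsD1 i) iS.
pose gi x j := if j == i then x else g j.
rewrite (@addF i
    (fun j => if j \in S :\ i then f0 j + f1 j else gi (f0 i) j)
    (fun j => if j \in S :\ i then f0 j + f1 j else gi (f1 i) j)); first last.
- by rewrite iS !inE eqxx /= /gi eqxx.
- by move=> j ji; rewrite !inE ji /= /gi (negPf ji).
- by move=> j ji; rewrite !inE ji /= /gi (negPf ji).
rewrite !IH // addrC [RHS](bigID (fun T => i \in T)) /=; congr (_ + _).
  rewrite [RHS](reindex_onto (fun T => i |: T) (fun T => T :\ i)) => [|T]; last first.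
    by case/andP=> _ iT; apply: setD1K.
  apply: eq_big => [T|T TS].
    rewrite setU11 andbT subUset sub1set iS /= subsetD1; congr (_ && _).
    apply/idP/eqP => [iT|<-]; last by rewrite setD11.
    exact: setU1K.
  apply: eqF => j; rewrite !inE /gi; case: eqVneq => [->|//] /=.
  by rewrite iS.
apply: eq_big => [T|T TS]; first by rewrite subsetD1.
apply: eqF => j; rewrite !inE /gi; case: eqVneq => [->|//] /=; rewrite iS.
by have /negPf -> : i \notin T by move: TS; rewrite subsetD1 => /andP[].
Qed.

End Expansion.

Section Multilinear.
Variables (C : fieldType) (A : algType C) (phi : {scalar A}).

Lemma cumulant_expand n (x y : A) :
  fcumulant1 phi n (x + y) =
  \sum_(T : {set 'I_n})
    fcumulant phi [seq if i \in T then y else x | i <- enum [set: 'I_n]].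
Proof.
have := @expand_slots n A C (fun f => fcumulant phi (map f (enum [set: 'I_n]))).
move=> /(_ _ _ setT (fun=> x) (fun=> y) (fun=> 0)) E.
transitivity (fcumulant phi [seq if i \in [set: 'I_n] then x + y else 0
  | i <- enum [set: 'I_n]]).
  congr (fcumulant phi _); apply/esym.
  rewrite (eq_map (g := fun=> x + y)) => [|i]; last by rewrite inE.
  rewrite -[in RHS](card_ord n) -cardsT cardE.
  by elim: (enum _) => //= j r ->.
rewrite E => [|f g eq_fg|i f g h fh gh hi].
- apply: eq_big => [T|T _]; first by rewrite subsetT.
  by congr (fcumulant phi _); apply: eq_map => i; rewrite inE.
- by congr (fcumulant phi _); apply: eq_map.
by apply: (cumulant_additive phi (in_setT i)).
Qed.

End Multilinear.

(** * Components of a noncrossing partition of paired points *)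

(** Induction along paths. *)
Lemma connect_invariant (T : finType) (e : rel T) (Q : pred T) x y :
  (forall z t, Q z -> e z t -> Q t) -> connect e x y -> Q x -> Q y.
Proof.
move=> clQ /connectP[p pth ->]; elim: p x pth => //= z p IH x /andP[xz pth] Qx.
by apply: IH pth _; apply: clQ xz.
Qed.

Section Components.
Variable n : nat.
Implicit Types (U V : {set 'I_n}) (i j k l : 'I_n) (W D : {set 'I_(2 * n)}).
Implicit Types (P : {set {set 'I_n}}) (p : {set {set 'I_(2 * n)}}).

Lemma half_ord_subproof (x : 'I_(2 * n)) : (x./2 < n)%N.
Proof. by rewrite ltn_half_double -mul2n. Qed.

Definition half_ord (x : 'I_(2 * n)) : 'I_n := Ordinal (half_ord_subproof x).

Lemma lt_half_ord (x y : 'I_(2 * n)) :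
  half_ord x != half_ord y -> (x < y)%N = (half_ord x < half_ord y)%N.
Proof.
rewrite -val_eqE /= => ne; have [lt|ge] := ltnP x y.
  by rewrite ltn_neqAle ne half_leq // ltnW.
by rewrite ltnNge half_leq.
Qed.

Definition doubled V : {set 'I_(2 * n)} := [set x | half_ord x \in V].

(** The edges of the graph of [p] are the pairs of points with the same half,
so the graph is connected exactly when its edges are connected through common
blocks. Working with edges, that is with ['I_n], makes the components a
partition of ['I_n]. *)
Definition linked p : rel 'I_n := fun k l =>
  [exists W in p, exists x in W, exists y in W,
     (half_ord x == k) && (half_ord y == l)].

Lemma linkedP p k l :
  reflect (exists W x y, [/\ W \in p, x \in W, y \in W, half_ord x = k & half_ord y = l])
          (linked p k l).
Proof.
apply: (iffP exists_inP) => [[W Wp /exists_inP[x xW /exists_inP[y yW /andP[/eqP xk /eqP yl]]]]|].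
  by exists W, x, y.
case=> W [x [y [Wp xW yW xk yl]]]; exists W => //; apply/exists_inP; exists x => //.
by apply/exists_inP; exists y => //; rewrite xk yl !eqxx.
Qed.

Lemma linked_block p W x y : W \in p -> x \in W -> y \in W ->
  linked p (half_ord x) (half_ord y).
Proof. by move=> Wp xW yW; apply/linkedP; exists W, x, y. Qed.

Lemma linked_sym p : symmetric (linked p).
Proof.
by move=> k l; apply/linkedP/linkedP => -[W [x [y [? ? ? ? ?]]]]; exists W, y, x.
Qed.

Lemma linked_connect_sym p : connect_sym (linked p).
Proof. exact/sym_connect_sym/linked_sym. Qed.

Definition components p V := equivalence_partition (connect (linked p)) V.

Lemma connect_linked_equiv p V :
  {in V & &, equivalence_rel (connect (linked p))}.
Proof.
move=> x y z _ _ _; split; first exact: connect0.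
by move=> xy; apply: (same_connect (@linked_connect_sym p)).
Qed.

Lemma components_partition p V : partition (components p V) V.
Proof. exact/equivalence_partitionP/connect_linked_equiv. Qed.

Lemma mem_component p V k : k \in V ->
  forall U, U \in components p V -> k \in U ->
  forall l, (l \in U) = (l \in V) && connect (linked p) k l.
Proof.
move=> kV U /imsetP[k' k'V ->]; rewrite !inE kV /= => kk l; rewrite inE.
by rewrite (same_connect (@linked_connect_sym p) kk).
Qed.

(** A block stays inside one gap of any other block. *)
Lemma same_side p (D : {set 'I_(2 * n)}) W1 W2 (w1 w2 x y : 'I_(2 * n)) :
  p \in NCon D -> W1 \in p -> W2 \in p -> W1 != W2 ->
  w1 \in W1 -> w2 \in W1 -> x \in W2 -> y \in W2 ->
  (w1 < x < w2)%N -> (w1 < y < w2)%N.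
Proof.
move=> /NConP[pp /noncrossingP nc] W1p W2p neW w1W w2W xW yW /andP[w1x xw2].
have neq w : w \in W1 -> nat_of_ord w != nat_of_ord y.
  move=> wW; apply: contra neW => /eqP/val_inj wy.
  by apply/eqP; apply: (block_uniq pp W1p W2p wW); rewrite wy.
apply/andP; split; rewrite ltnNge; apply: contra neW => le.
  apply/eqP/esym/(nc _ _ W2p W1p y w1 x w2) => //.
  by rewrite ltn_neqAle eq_sym neq.
apply/eqP/(nc _ _ W1p W2p w1 x w2 y) => //.
by rewrite ltn_neqAle neq.
Qed.

Section Noncrossing.
Variables (p : {set {set 'I_(2 * n)}}) (V0 : {set 'I_n}).
Hypothesis pN : p \in NCon (doubled V0).

(** The component of [j], not meeting the block [W], stays inside one gap of it:
its blocks do by [same_side], and the two points of a pair are neighbours. *)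
Let same_gap (i j l : 'I_n) W (w1 w2 : 'I_(2 * n)) :
  ~~ connect (linked p) i j -> connect (linked p) j l ->
  W \in p -> w1 \in W -> w2 \in W -> connect (linked p) i (half_ord w1) ->
  (half_ord w1 < j < half_ord w2)%N = (half_ord w1 < l < half_ord w2)%N.
Proof.
move=> nij jl Wp w1W w2W iw1.
have iw2 : connect (linked p) i (half_ord w2).
  exact: connect_trans iw1 (connect1 (linked_block Wp w1W w2W)).
have neq k w : connect (linked p) j k -> connect (linked p) i (half_ord w) ->
    half_ord w != k.
  move=> jk iw; apply: contra nij => /eqP wk; apply: connect_trans iw _.
  by rewrite wk linked_connect_sym.
pose side k := (half_ord w1 < k < half_ord w2)%N.
pose Q k := connect (linked p) j k && (side k == side j).
suff /andP[_ /eqP] : Q l by rewrite /side => ->.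
apply: (connect_invariant _ jl); last by rewrite /Q connect0 eqxx.
move=> k k' /andP[jk /eqP sk] kk'; have jk' := connect_trans jk (connect1 kk').
rewrite /Q jk' /= -{}sk; case/linkedP: kk' => W' [x [y [W'p xW' yW' xk yk']]]; subst k k'.
have neW : W != W'.
  apply: contra nij => /eqP WW'; rewrite -WW' in xW'.
  apply: connect_trans iw1 (connect_trans (connect1 (linked_block Wp w1W xW')) _).
  by rewrite linked_connect_sym.
have E z : connect (linked p) j (half_ord z) -> side (half_ord z) = (w1 < z < w2)%N.
  move=> jz; rewrite /side -!lt_half_ord //; first by rewrite eq_sym neq.
  by rewrite neq.
rewrite !E //; apply/eqP; apply/idP/idP; exact: (same_side pN Wp W'p).
Qed.

(** The component of [i] does not leave the arc between two points [j] and [l]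
of another component, since a block with one point inside the arc and another
one outside it would separate [j] from [l], against [same_gap]. *)
Let same_arc (i j k l : 'I_n) :
  ~~ connect (linked p) i j -> connect (linked p) j l -> (j < l)%N ->
  connect (linked p) i k -> (j < k < l)%N = (j < i < l)%N.
Proof.
move=> nij jl jltl ik; pose Q k := connect (linked p) i k && ((j < k < l)%N == (j < i < l)%N).
suff /andP[_ /eqP] : Q k by [].
apply: (connect_invariant _ ik); last by rewrite /Q connect0 eqxx.
move=> {ik}k k' /andP[ik /eqP sk] kk'; have ik' := connect_trans ik (connect1 kk').
rewrite /Q ik' /= -{}sk; case/linkedP: kk' => W [x [y [Wp xW yW xk yk']]]; subst k k'.
have neq t k : connect (linked p) j t -> connect (linked p) i k ->
    nat_of_ord t != nat_of_ord k.
  move=> jt it; apply: contra nij => /eqP/val_inj tk; apply: connect_trans it _.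
  by rewrite -tk linked_connect_sym.
have imp z t : z \in W -> t \in W -> connect (linked p) i (half_ord z) ->
    connect (linked p) i (half_ord t) ->
    (j < half_ord z < l)%N -> (j < half_ord t < l)%N.
  move=> zW tW iz it /andP[jz zl]; have S1 := same_gap nij jl Wp zW tW iz.
  have S2 := same_gap nij jl Wp tW zW it; move: S1 S2.
  have := neq l (half_ord t) jl it; have := neq j (half_ord t) (connect0 _ _) it.
  have arith (j0 l0 z0 t0 : nat) : (j0 < z0)%N -> (z0 < l0)%N ->
      j0 != t0 -> l0 != t0 -> (z0 < j0 < t0)%N = (z0 < l0 < t0)%N ->
      (t0 < j0 < z0)%N = (t0 < l0 < z0)%N -> (j0 < t0 < l0)%N.
    move=> jz0 zl0 jt0 lt0 E1 E2; apply/andP; split; rewrite ltnNge leq_eqVlt.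
      rewrite eq_sym (negPf jt0) /=; apply/negP => tj; move: E2.
      by rewrite tj jz0 [(l0 < z0)%N]ltnNge (ltnW zl0) andbF.
    rewrite (negPf lt0) /=; apply/negP => lt1; move: E1.
    by rewrite zl0 lt1 [(z0 < j0)%N]ltnNge (ltnW jz0).
  by move=> jt lt S1 S2; apply: arith S1 S2.
by apply/eqP; apply/idP/idP; apply: imp.
Qed.

(** A crossing [i < j < k < l] of two components would have [k] inside the arc
from [j] to [l] and [i] outside it. *)
Lemma components_noncrossing : noncrossing (components p V0).
Proof.
apply/noncrossingP => X Y XP YP i j k l iX jY kX lY ij jk kl.
have pP := components_partition p V0.
have sX := subsetP (block_sub pP XP); have sY := subsetP (block_sub pP YP).
have := kX; rewrite (mem_component (sX _ iX) XP iX) => /andP[_ ik].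
have := lY; rewrite (mem_component (sY _ jY) YP jY) => /andP[_ jl].
have [ijc|nij] := boolP (connect (linked p) i j).
  apply: (block_uniq pP XP YP _ jY); rewrite (mem_component (sX _ iX) XP iX) ijc.
  by rewrite sY.
have := same_arc nij jl (ltn_trans jk kl) ik; rewrite jk kl.
by rewrite [(j < i)%N]ltnNge (ltnW ij).
Qed.

Lemma components_NCon : components p V0 \in NCon V0.
Proof. by rewrite inE components_partition components_noncrossing. Qed.

End Noncrossing.

End Components.

(** * Noncrossing partitions sorted by their components *)

Section Fibers.
Variable n : nat.
Implicit Types (U V : {set 'I_n}) (i j k l : 'I_n) (W D : {set 'I_(2 * n)}).
Implicit Types (P : {set {set 'I_n}}) (p : {set {set 'I_(2 * n)}}).
Implicit Types (f : {ffun {set 'I_n} -> {set {set 'I_(2 * n)}}}).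

Definition all_linked U p := [forall k in U, forall l in U, connect (linked p) k l].

Lemma all_linkedP U p :
  reflect {in U &, forall k l, connect (linked p) k l} (all_linked U p).
Proof.
apply: (iffP forall_inP) => [h k l kU lU|h k kU]; first exact: forall_inP (h k kU) l lU.
by apply/forall_inP => l; apply: h.
Qed.

Definition NCon_linked U := [set p in NCon (doubled U) | all_linked U p].

Definition blocks_in p U := [set W in p | W \subset doubled U].

Lemma mem_doubled U x : (x \in doubled U) = (half_ord x \in U).
Proof. by rewrite inE. Qed.

Lemma block_in_component p V U W x : p \in NCon (doubled V) ->
  U \in components p V -> W \in p -> x \in W -> half_ord x \in U ->
  W \subset doubled U.
Proof.
move=> pN UP Wp xW xU; apply/subsetP => y yW; rewrite mem_doubled.
have sub z : z \in W -> half_ord z \in V.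
  by move=> zW; rewrite -mem_doubled (subsetP (NCon_block_sub pN Wp)).
rewrite (mem_component (sub x xW) UP xU) sub //=.
exact/connect1/(linked_block Wp).
Qed.

(** Paths that start in a component use only blocks of that component. *)
Lemma blocks_in_component p V U : p \in NCon (doubled V) ->
  U \in components p V -> blocks_in p U \in NCon_linked U.
Proof.
move=> pN UP; have [pp pnc] := NConP pN.
have sUV := subsetP (block_sub (components_partition p V) UP).
have sub W : W \in blocks_in p U -> W \in p by rewrite inE => /andP[].
rewrite inE inE; apply/andP; split; first (apply/andP; split).
- apply: partition_intro => [W /sub|W|x xU|W1 W2 x /sub W1p /sub W2p].
  + exact: NCon_block_neq0 pN.
  + by rewrite inE => /andP[].
  + rewrite mem_doubled in xU; have xc : x \in cover p.
      by rewrite (cover_partition pp) mem_doubled sUV.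
    exists (pblock p x); last by rewrite mem_pblock.
    rewrite inE pblock_mem //; apply: (block_in_component pN UP) xU => //.
      exact: pblock_mem.
    by rewrite mem_pblock.
  + exact: (block_uniq pp).
- by apply: noncrossingS pnc; apply/subsetP.
apply/all_linkedP => k l kU lU.
have := lU; rewrite (mem_component (sUV _ kU) UP kU) => /andP[_ kl].
pose Q t := (t \in U) && connect (linked (blocks_in p U)) k t.
suff /andP[] : Q l by [].
apply: (connect_invariant _ kl); last by rewrite /Q kU connect0.
move=> t t' /andP[tU kt] /linkedP[W [x [y [Wp xW yW xt yt']]]]; subst t t'.
have WU := block_in_component pN UP Wp xW tU.
rewrite /Q -mem_doubled (subsetP WU y yW) /=; apply: connect_trans kt (connect1 _).
by apply: (@linked_block _ _ W) => //; rewrite inE Wp.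
Qed.

(** Conversely, connected partitions chosen inside the blocks of a noncrossing
partition [P] unite into a partition whose components are the blocks of
[P]. The value of [f] is empty outside [P], so the union may range over all
sets. *)
Section Glue.
Variables (V : {set 'I_n}) (P : {set {set 'I_n}}).
Variable f : {set 'I_n} -> {set {set 'I_(2 * n)}}.
Hypothesis PN : P \in NCon V.
Hypothesis fP : forall U, U \in P -> f U \in NCon_linked U.
Hypothesis f0 : forall U, U \notin P -> f U = set0.

Let pP : partition P V. Proof. by case: (NConP PN). Qed.

Lemma glue_inP W : W \in \bigcup_U f U ->
  exists U, [/\ U \in P, W \in f U, f U \in NCon (doubled U) & all_linked U (f U)].
Proof.
case/bigcupP => U _ WU; exists U; have UP : U \in P.
  by apply: contraLR WU => /f0 ->; rewrite inE.
by split=> //; have := fP UP; rewrite inE => /andP[].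
Qed.

Lemma glue_mem U W : W \in f U -> W \in \bigcup_U f U.
Proof. by move=> WU; apply/bigcupP; exists U. Qed.

Lemma glue_half U W x : U \in P -> W \in f U -> x \in W -> half_ord x \in U.
Proof.
move=> UP WU xW; have := fP UP; rewrite inE => /andP[fN _].
by rewrite -mem_doubled (subsetP (NCon_block_sub fN WU)).
Qed.

(** A crossing of blocks chosen in different members of [P] is a crossing of
these members, because points with different halves are ordered as their
halves are. *)
Lemma glue_NCon : \bigcup_U f U \in NCon (doubled V).
Proof.
rewrite inE; apply/andP; split.
  apply: partition_intro => [W|W|x xV|W1 W2 x].
  - by case/glue_inP => U [_ WU fN _]; apply: NCon_block_neq0 fN WU.
  - case/glue_inP => U [UP WU fN _]; apply/subsetP => x xW; rewrite mem_doubled.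
    by rewrite (subsetP (block_sub pP UP)) // (glue_half UP WU).
  - rewrite mem_doubled in xV; have xc : half_ord x \in cover P.
      by rewrite (cover_partition pP).
    have UP := pblock_mem xc; have := fP UP; rewrite inE => /andP[/NConP[fp _] _].
    have xf : x \in cover (f (pblock P (half_ord x))).
      by rewrite (cover_partition fp) mem_doubled mem_pblock.
    exists (pblock (f (pblock P (half_ord x))) x); last by rewrite mem_pblock.
    by apply: (@glue_mem (pblock P (half_ord x))); apply: pblock_mem.
  case/glue_inP => U1 [U1P W1U f1N _] /glue_inP[U2 [U2P W2U _ _]] xW1 xW2.
  have UU := block_uniq pP U1P U2P (glue_half U1P W1U xW1) (glue_half U2P W2U xW2).
  by subst U2; case/NConP: f1N => fp _; apply: (block_uniq fp) xW1 xW2.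
apply/noncrossingP => W1 W2 /glue_inP[U1 [U1P W1U f1N _]] /glue_inP[U2 [U2P W2U _ _]].
move=> i j k l iW jW kW lW ij jk kl.
have [UU|neU] := eqVneq U1 U2.
  by subst U2; case/NConP: f1N => _ /noncrossingP h; apply: (h _ _ _ _ i j k l).
have [_ /noncrossingP ncP] := NConP PN.
have lt x y U U' W W' : U \in P -> U' \in P -> U != U' -> W \in f U -> W' \in f U' ->
    x \in W -> y \in W' -> (x < y)%N = (half_ord x < half_ord y)%N.
  move=> UP UP' ne WU WU' xW yW; apply: lt_half_ord; apply: contra ne => /eqP xy.
  apply/eqP/(block_uniq pP UP UP' (glue_half UP WU xW)).
  by rewrite xy; apply: glue_half WU' yW.
have neU' : U2 != U1 by rewrite eq_sym.
case/eqP: neU; apply: (ncP _ _ U1P U2P (half_ord i) (half_ord j) (half_ord k) (half_ord l)).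
- exact: glue_half W1U iW.
- exact: glue_half W2U jW.
- exact: glue_half W1U kW.
- exact: glue_half W2U lW.
- by rewrite -(lt _ _ U1 U2 W1 W2) //; apply/eqP => UU; rewrite UU eqxx in neU'.
- by rewrite -(lt _ _ U2 U1 W2 W1).
by rewrite -(lt _ _ U1 U2 W1 W2) //; apply/eqP => UU; rewrite UU eqxx in neU'.
Qed.

Lemma glue_components : components (\bigcup_U f U) V = P.
Proof.
rewrite -[RHS](equivalence_partition_pblock pP) /components /equivalence_partition.
apply: eq_in_imset => k kV; apply/setP => l; rewrite !inE; apply: andb_id2l => lV.
have kc : k \in cover P by rewrite (cover_partition pP).
have UP := pblock_mem kc; apply/idP/idP => [kl|lU].
  apply: (@connect_invariant _ _ (mem (pblock P k)) _ _ _ kl); last by rewrite /= mem_pblock.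
  move=> t t' /= tU /linkedP[W [x [y [/glue_inP[U [U'P WU _ _]] xW yW xt yt']]]].
  subst t t'; rewrite (block_uniq pP UP U'P tU (glue_half U'P WU xW)).
  exact: glue_half WU yW.
have := fP UP; rewrite inE => /andP[_ /all_linkedP /(_ k l)].
rewrite mem_pblock => /(_ kc lU); apply: connect_sub => t t' /linkedP.
case=> W [x [y [WU xW yW <- <-]]]; apply/connect1/(@linked_block _ _ W) => //.
exact: glue_mem WU.
Qed.

Lemma glue_blocks_in U : U \in P -> blocks_in (\bigcup_U f U) U = f U.
Proof.
move=> UP; apply/setP => W; rewrite inE; apply/andP/idP => [[]|WU]; last first.
  split; first exact: glue_mem WU.
  by apply/subsetP => x xW; rewrite mem_doubled (glue_half UP WU).
case/glue_inP => U' [U'P WU fN _] /subsetP sW.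
have /set0Pn[x xW] := NCon_block_neq0 fN WU.
have xU := sW x xW; rewrite mem_doubled in xU.
by rewrite (block_uniq pP UP U'P xU (glue_half U'P WU xW)).
Qed.

Lemma glue_disjoint U1 U2 : U1 != U2 -> [disjoint f U1 & f U2].
Proof.
move=> ne; apply/pred0Pn => -[W /= /andP[WU1 WU2]].
have UP U : W \in f U -> U \in P.
  by move=> WU; apply: contraLR WU => /f0 ->; rewrite inE.
have := fP (UP _ WU1); rewrite inE => /andP[fN _].
have /set0Pn[x xW] := NCon_block_neq0 fN WU1.
case/eqP: ne; apply: (block_uniq pP (UP _ WU1) (UP _ WU2)).
  exact: glue_half (UP _ WU1) WU1 xW.
exact: glue_half (UP _ WU2) WU2 xW.
Qed.

End Glue.

Variables (C : comNzRingType) (kap : {set 'I_(2 * n)} -> C).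

(** Cutting a partition along its components and gluing are inverse to each
other, and the weight is multiplicative. *)
Lemma fiber_sum V P : P \in NCon V ->
  \sum_(p in NCon (doubled V) | components p V == P) \prod_(W in p) kap W =
  \prod_(U in P) \sum_(p in NCon_linked U) \prod_(W in p) kap W.
Proof.
move=> PN; rewrite (big_distr_big_dep set0) /=.
rewrite (reindex_onto (fun f : {ffun {set 'I_n} -> {set {set 'I_(2 * n)}}} =>
    \bigcup_U f U)
  (fun p => [ffun U => if U \in P then blocks_in p U else set0])) /=; last first.
  move=> p /andP[pN /eqP pP]; apply/setP => W; apply/bigcupP/idP => [[U _]|Wp].
    by rewrite ffunE; case: ifP => _; rewrite inE // => /andP[].
  have /set0Pn[x xW] := NCon_block_neq0 pN Wp.
  have xV : half_ord x \in V.
    by rewrite -mem_doubled (subsetP (NCon_block_sub pN Wp)).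
  have xc : half_ord x \in cover P.
    by rewrite (cover_partition (proj1 (NConP PN))).
  exists (pblock P (half_ord x)); rewrite // ffunE pblock_mem // inE Wp /=.
  apply: (block_in_component pN _ Wp xW); rewrite ?mem_pblock //.
  by rewrite pP pblock_mem.
have familyP (f : {ffun {set 'I_n} -> {set {set 'I_(2 * n)}}}) :
    reflect ((forall U, U \in P -> f U \in NCon_linked U) /\
             (forall U, U \notin P -> f U = set0))
      (f \in pfamily set0 (mem P) NCon_linked).
  apply: (iffP pfamilyP) => [[/subsetP supp fP]|[fP f0]]; split=> //.
    by move=> U UP; apply/eqP; apply: contraNT UP => /supp.
  by apply/subsetP => U; apply: contraR => /f0 /eqP.
apply: eq_big => [f|f].
  apply/andP/familyP => [[/andP[pN /eqP pP] /eqP fE]|[fP f0]].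
    split=> U UP; rewrite -fE ffunE ?UP ?(negPf UP) //.
    by apply: (blocks_in_component pN); rewrite pP.
  rewrite (glue_NCon PN fP f0) (glue_components PN fP f0) eqxx; split=> //.
  apply/eqP/ffunP => U; rewrite ffunE; case: ifP => [UP|/negbT /f0 //].
  exact: glue_blocks_in PN fP f0 U UP.
case/andP => /andP[pN /eqP pP] /eqP fE.
have fP U : U \in P -> f U \in NCon_linked U.
  by move=> UP; rewrite -fE ffunE UP; apply: (blocks_in_component pN); rewrite pP.
have f0 U : U \notin P -> f U = set0 by move=> UP; rewrite -fE ffunE (negPf UP).
rewrite partition_disjoint_bigcup; last exact: glue_disjoint PN fP f0.
rewrite [RHS]big_mkcond; apply: eq_bigr => U _.
by case: ifP => // /negbT /f0 ->; rewrite big_set0.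
Qed.

Lemma components_sum V :
  \sum_(p in NCon (doubled V)) \prod_(W in p) kap W =
  \sum_(P in NCon V) \prod_(U in P)
    \sum_(p in NCon_linked U) \prod_(W in p) kap W.
Proof.
rewrite (partition_big (fun p => components p V) (mem (NCon V))) /=; last first.
  by move=> p; apply: components_NCon.
by apply: eq_bigr => P PN; apply: fiber_sum.
Qed.

End Fibers.

(** * Cumulants with products as entries *)

Section Points.
Variable n : nat.
Implicit Types (V : {set 'I_n}) (k : 'I_n) (x : 'I_(2 * n)).

Lemma half_fst_point k : half_ord (fst_point k) = k.
Proof. by apply: val_inj; rewrite /= mul2n half_double. Qed.

Lemma half_snd_point k : half_ord (snd_point k) = k.
Proof. by apply: val_inj; rewrite /= mul2n uphalf_double. Qed.

Lemma point_halfE x :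
  x = if odd x then snd_point (half_ord x) else fst_point (half_ord x).
Proof.
apply: val_inj; rewrite -[LHS]odd_double_half.
by case: (odd x); rewrite /= -(mul2n x./2) ?add1n ?add0n.
Qed.

Lemma enum_doubled V :
  enum (doubled V) = flatten [seq [:: fst_point k; snd_point k] | k <- enum V].
Proof.
apply: (irr_sorted_eq (@ord_lt_trans _) (@ord_lt_irr _)).
- exact: sorted_enum_ord.
- have := sorted_enum_ord V; rewrite !(sorted_pairwise (@ord_lt_trans _)).
  elim: (enum V) => //= k s IH /andP[/allP ks /IH {}IH].
  have lt (u v : nat) : (u < v)%N -> (u.*2.+1 < v.*2)%N.
    by rewrite -leq_double doubleS.
  rewrite IH /ord_lt /= ltnSn !andbT /=.
  apply/andP; split; apply/allP => x /flatten_mapP[l /ks kl]; rewrite !inE;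
    move=> /orP[] /eqP -> /=; rewrite !(mul2n k) !(mul2n l); have h := lt k l kl;
    by rewrite (@leq_ltn_trans k.*2.+1) // (leq_trans h).
move=> x; rewrite mem_enum inE; apply/idP/flatten_mapP => [xV|[k]].
  exists (half_ord x); rewrite ?mem_enum // !inE {1 3}(point_halfE x).
  by case: (odd x); rewrite eqxx ?orbT.
rewrite mem_enum !inE => kV /orP[] /eqP ->.
  by rewrite half_fst_point.
by rewrite half_snd_point.
Qed.

End Points.

Section Products.
Variables (C : fieldType) (A : algType C) (phi : {scalar A}).

(** By [components_sum] the right-hand sides satisfy the moment-cumulant formula
of the products; the terms with several blocks agree by induction. *)
Theorem cumulant_of_products n (f : 'I_(2 * n) -> A) (V : {set 'I_n}) :
  V != set0 ->
  fcumulant phi [seq f (fst_point k) * f (snd_point k) | k <- enum V] =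
  \sum_(p in NCon_linked V) \prod_(W in p) fcumulant phi (map f (enum W)).
Proof.
have [m] := ubnP #|V|; elim: m V => // m IH V Vm V0.
rewrite cumulant_onE //.
have -> : \prod_(k <- enum V) (f (fst_point k) * f (snd_point k)) =
          \prod_(x <- enum (doubled V)) f x.
  rewrite enum_doubled; elim: (enum V) => [|k s IHs]; first by rewrite !big_nil.
  by rewrite big_cons IHs /= !big_cons mulrA.
have dV0 : doubled V != set0.
  case/set0Pn: V0 => k kV; apply/set0Pn; exists (fst_point k).
  by rewrite mem_doubled half_fst_point.
rewrite moment_cumulant_on //.
rewrite (components_sum (fun W => fcumulant phi (map f (enum W)))).
rewrite (bigD1 _ (NCon_one_block V0)) /= big_set1 -[RHS]addr0 -addrA.
congr (_ + _); apply/eqP; rewrite subr_eq0; apply/eqP.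
apply: eq_bigr => P /andP[PN neP]; apply: eq_bigr => U UP; rewrite IH //.
  by rewrite -ltnS; apply: leq_trans Vm; rewrite ltnS; apply: NCon_block_lt UP.
exact: (NCon_block_neq0 PN UP).
Qed.

End Products.

(** * Two-colourings of a connected noncrossing partition *)

Section Colourings.
Variable n : nat.
Hypothesis n0 : (0 < n)%N.
Implicit Types (T : {set 'I_n}) (W : {set 'I_(2 * n)}).
Implicit Types (p : {set {set 'I_(2 * n)}}).

(** The letter at position [x], [true] for [b], when the slots in [T] hold [ba]
and the other ones hold [ab]. *)
Definition colour T (x : 'I_(2 * n)) : bool := (half_ord x \in T) (+) odd x.

Definition monochromatic T p :=
  [forall W in p, [forall x in W, forall y in W, colour T x == colour T y]].

Lemma monochromaticP T p :
  reflect (forall W x y, W \in p -> x \in W -> y \in W -> colour T x = colour T y)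
          (monochromatic T p).
Proof.
apply: (iffP forall_inP) => [h W x y Wp xW yW|h W Wp].
  exact/eqP/(forall_inP (forall_inP (h W Wp) x xW) y yW).
by apply/forall_inP => x xW; apply/forall_inP => y yW; apply/eqP/(h W).
Qed.

Lemma colour_fst T k : colour T (fst_point k) = (k \in T).
Proof. by rewrite /colour half_fst_point /= mul2n odd_double addbF. Qed.

Lemma colour_snd T k : colour T (snd_point k) = (k \notin T).
Proof. by rewrite /colour half_snd_point /= mul2n odd_double addbT. Qed.

Lemma doubledT : doubled [set: 'I_n] = [set: 'I_(2 * n)].
Proof. by apply/setP => x; rewrite !inE. Qed.

Lemma NCon_doubledT : NCon (doubled [set: 'I_n]) = NC (2 * n).
Proof. by rewrite doubledT. Qed.

Section OnePartition.
Variable p : {set {set 'I_(2 * n)}}.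
Hypothesis pN : p \in NCon (doubled [set: 'I_n]).

Let pp : partition p (doubled [set: 'I_n]). Proof. by case: (NConP pN). Qed.

Let mem_p x : x \in cover p.
Proof. by rewrite (cover_partition pp) mem_doubled inE. Qed.

Let pb x : pblock p x \in p. Proof. exact: pblock_mem. Qed.

Let xpb x : x \in pblock p x. Proof. by rewrite mem_pblock. Qed.

Let pblockE W x : W \in p -> x \in W -> pblock p x = W.
Proof. by move=> Wp xW; apply: def_pblock => //; case/and3P: pp. Qed.

(** Two blocks are adjacent when they meet a common pair and two pairs are
linked when they meet a common block, so paths of one kind translate into paths
of the other kind. *)
Lemma connected_pair_graphE :
  connected_graph (pair_graph p) = all_linked [set: 'I_n] p.
Proof.
apply/andP/all_linkedP => [[_ /forall_inP h] k l _ _|h].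
  have uv := forall_inP (h _ (pb (fst_point k))) _ (pb (fst_point l)).
  pose Q W := [forall x in W, connect (linked p) k (half_ord x)].
  have /forall_inP/(_ _ (xpb _)) : Q (pblock p (fst_point l)).
    apply: (connect_invariant _ uv); last first.
      apply/forall_inP => x xW; rewrite -{1}(half_fst_point k); apply: connect1.
      exact: (linked_block (pb (fst_point k))).
    have step e x y : x \in [:: fst_point e; snd_point e] ->
        y \in [:: fst_point e; snd_point e] -> Q (pblock p x) -> Q (pblock p y).
      move=> xe ye /forall_inP /(_ _ (xpb x)) kx; apply/forall_inP => z zW.
      have he w : w \in [:: fst_point e; snd_point e] -> half_ord w = e.
        by rewrite !inE => /orP[] /eqP->; rewrite ?half_fst_point ?half_snd_point.
      rewrite (he _ xe) -(he _ ye) in kx; apply: connect_trans kx (connect1 _).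
      exact: (linked_block (pb y)).
    move=> u v Qu /existsP[e] /orP[] /eqP[uE vE]; move: Qu; rewrite -uE -vE;
      by apply: (step e); rewrite !inE eqxx ?orbT.
  by rewrite half_fst_point.
split.
  apply/set0Pn; exists (pblock p (fst_point (Ordinal n0))); exact: pb.
apply/forall_inP => u up; apply/forall_inP => v vp.
have /set0Pn[x xu] := NCon_block_neq0 pN up.
have /set0Pn[y yv] := NCon_block_neq0 pN vp.
set adj := adjacent (pair_graph p).
pose Q k := connect adj u (pblock p (fst_point k)) && connect adj u (pblock p (snd_point k)).
have QE z : connect adj u (pblock p z) -> Q (half_ord z).
  have e1 k : adj (pblock p (fst_point k)) (pblock p (snd_point k)).
    by apply/existsP; exists k; rewrite eqxx.
  have e2 k : adj (pblock p (snd_point k)) (pblock p (fst_point k)).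
    by apply/existsP; exists k; rewrite eqxx orbT.
  rewrite {1}(point_halfE z) /Q; case: ifP => _ uz; rewrite uz ?andbT /=.
    exact: connect_trans uz (connect1 (e2 _)).
  exact: connect_trans uz (connect1 (e1 _)).
have Qz z : Q (half_ord z) -> connect adj u (pblock p z).
  by rewrite {2}(point_halfE z) => /andP[]; case: ifP.
have xy := h (half_ord x) (half_ord y) (in_setT _) (in_setT _).
rewrite -(pblockE vp yv); apply: (Qz); apply: (connect_invariant _ xy); last first.
  by apply: QE; rewrite (pblockE up xu).
move=> k k' Qk /linkedP[W [z [t [Wp zW tW zk tk']]]]; subst k k'.
by apply: QE; rewrite (pblockE Wp tW) -(pblockE Wp zW); apply: Qz.
Qed.

Lemma monochromaticC T : monochromatic T p -> monochromatic (~: T) p.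
Proof.
move=> /monochromaticP h; apply/monochromaticP => W x y Wp xW yW.
have := h W x y Wp xW yW; rewrite /colour !inE !addNb => ->; by [].
Qed.

(** The two sides are the blocks of either colour. *)
Lemma monochromatic_bipartite T :
  monochromatic T p -> bipartite_graph (pair_graph p).
Proof.
move=> /monochromaticP h.
pose X c := [set W in p | [exists x in W, colour T x == c]].
have inX x : pblock p x \in X (colour T x).
  by rewrite inE pb; apply/exists_inP; exists x.
apply/existsP; exists (X true); apply/existsP; exists (X false); apply/and3P; split.
- rewrite eqEsubset subUset; apply/andP; split.
    by apply/andP; split; apply/subsetP => W; rewrite inE => /andP[].
  apply/subsetP => W Wp; have /set0Pn[x xW] := NCon_block_neq0 pN Wp.
  rewrite -(pblockE Wp xW) inE; have := inX x.
  by case: (colour T x) => ->; rewrite ?orbT.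
- apply/pred0Pn => -[W /= /andP[]]; rewrite !inE => /andP[Wp /exists_inP[x xW /eqP xt]].
  by case/andP=> _ /exists_inP[y yW]; rewrite -(h W x y Wp xW yW) xt.
apply/forallP => e /=; have := inX (fst_point e); have := inX (snd_point e).
rewrite colour_fst colour_snd; case: (e \in T) => /= -> ->; rewrite ?orbT //.
Qed.

(** The first point of each pair gets the colour of the side that contains its
block; the second point then has its own side's colour as well, since the edge
goes from one side to the other. *)
Lemma bipartite_monochromatic :
  bipartite_graph (pair_graph p) -> exists T, monochromatic T p.
Proof.
case/existsP => X /existsP[Y /and3P[_ dis /forallP edge]].
exists [set k | pblock p (fst_point k) \in X]; set T := [set k | _].
suff cE x : colour T x = (pblock p x \in X).
  apply/monochromaticP => W x y Wp xW yW; rewrite !cE.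
  by rewrite (pblockE Wp xW) (pblockE Wp yW).
have nXY W : W \in Y -> W \notin X.
  by move=> WY; apply: contraTN dis => WX; apply/pred0Pn; exists W; rewrite /= WX.
rewrite (point_halfE x); case: ifP => _; last by rewrite colour_fst inE.
rewrite colour_snd inE; case/orP: (edge (half_ord x)) => /= /andP[].
  by move=> -> /nXY /negPf ->.
by move=> /nXY -> ->.
Qed.

(** Whether two colourings agree on a pair is the same for linked pairs, hence
for all pairs; so they are equal or complementary. *)
Lemma card_monochromatic : all_linked [set: 'I_n] p ->
  #|[set T | monochromatic T p]| =
  if bipartite_graph (pair_graph p) then 2%N else 0%N.
Proof.
move=> /all_linkedP lk; case: ifP => [/bipartite_monochromatic[T0 T0p]|nb]; last first.
  by apply: eq_card0 => T; rewrite inE; apply: contraFF nb; apply: monochromatic_bipartite.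
suff -> : [set T | monochromatic T p] = [set T0; ~: T0].
  rewrite cards2; suff -> : T0 != ~: T0 by [].
  apply/eqP => /setP/(_ (Ordinal n0)); rewrite inE; by case: (_ \in _).
apply/setP => T; rewrite !inE; apply/idP/orP => [Tp|[] /eqP -> //]; last first.
  exact: monochromaticC.
pose d k := (k \in T) (+) (k \in T0).
have dE k l : d k = d l.
  have kl := lk k l (in_setT _) (in_setT _).
  apply/esym/eqP; apply: (@connect_invariant _ _ (fun t => d t == d k) _ _ _ kl) => //.
  move=> t t' /eqP <- /linkedP[W [x [y [Wp xW yW <- <-]]]].
  have := monochromaticP _ _ Tp W x y Wp xW yW.
  have := monochromaticP _ _ T0p W x y Wp xW yW.
  rewrite /colour /d.
  by case: (odd x) (odd y) (_ \in T) (_ \in T) (_ \in T0) (_ \in T0) => [] [] [] [] [] [].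
have dk k := dE k (Ordinal n0); case d0: (d (Ordinal n0)) dk => dk; [right|left].
  by apply/eqP/setP => k; rewrite inE; have := dk k; rewrite /d; do 2!case: (_ \in _).
by apply/eqP/setP => k; have := dk k; rewrite /d; do 2!case: (_ \in _).
Qed.

End OnePartition.

Lemma X2E : X2 n =
  [set p in NCon_linked [set: 'I_n] | bipartite_graph (pair_graph p)].
Proof.
rewrite /X2 /NCon_linked -NCon_doubledT; apply/setP => p.
rewrite [LHS]in_set [RHS]in_set [p \in [set _ in _ | all_linked _ _]]in_set.
have [pN|//] /= := boolP (p \in NCon _).
by rewrite connected_pair_graphE.
Qed.

Variables (C : comNzRingType) (lam : nat -> C).

Lemma prod_mono_cumulant T p :
  \prod_(W in p) mono_cumulant lam (map (colour T) (enum W)) =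
  (monochromatic T p)%:R * \prod_(W in p) lam #|W|.
Proof.
have E W : mono_cumulant lam (map (colour T) (enum W)) =
    [forall x in W, forall y in W, colour T x == colour T y]%:R * lam #|W|.
  rewrite /mono_cumulant size_map -cardE.
  suff -> : constant (map (colour T) (enum W)) =
      [forall x in W, forall y in W, colour T x == colour T y].
    by case: ifP => _; rewrite ?mul1r ?mul0r.
  apply/idP/forall_inP => [|h].
    case/(constantP true) => c cE x xW; apply/forall_inP => y yW.
    have cz z : z \in W -> colour T z = c.
      rewrite -mem_enum => /(map_f (colour T)); rewrite {1}cE mem_nseq.
      by case/andP => _ /eqP.
    by rewrite !cz.
  have : {subset enum W <= W} by move=> x; rewrite mem_enum.
  case: (enum W) => //= x s sW; apply/allP => _ /mapP[y ys ->].
  apply: (forall_inP (h y _)); apply: sW; by rewrite inE ?eqxx ?ys ?orbT.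
rewrite (eq_bigr _ (fun W _ => E W)) big_split /=; congr (_ * _).
have [/forall_inP h|/forall_inPn[W Wp nW]] := boolP (monochromatic T p).
  by rewrite big1 // => W /h ->.
by rewrite (bigD1 W) //= (negPf nW) mul0r.
Qed.

End Colourings.

(** * The anticommutator *)

Theorem corollary1p5 (R : realType) (A : algType (complex R))
    (phi : {scalar A}) (phi1 : phi 1 = 1) (a b : A)
    (free_ab : free_pair phi a b)
    (same_ab : same_distribution phi a b)
    (lambda : nat -> complex R)
    (lambda_a : forall n : nat, (1 <= n)%N -> lambda n = fcumulant1 phi n a) :
  forall n : nat, (1 <= n)%N ->
    fcumulant1 phi n (a * b + b * a) =
    2 * \sum_(P in X2 n) \prod_(V in P) lambda #|V|.
Proof.
move=> n n0; rewrite cumulant_expand; pose lam k := fcumulant1 phi k a.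
have T0 : [set: 'I_n] != set0 by apply/set0Pn; exists (Ordinal n0).
have wordE (T : {set 'I_n}) :
    fcumulant phi [seq if k \in T then b * a else a * b | k <- enum [set: 'I_n]] =
    \sum_(p in NCon_linked [set: 'I_n])
      (monochromatic T p)%:R * \prod_(W in p) lam #|W|.
  pose f := letter a b \o colour T.
  transitivity (fcumulant phi
      [seq f (fst_point k) * f (snd_point k) | k <- enum [set: 'I_n]]).
    congr (fcumulant phi _); apply: eq_map => k.
    by rewrite /f /= colour_fst colour_snd; case: ifP.
  rewrite cumulant_of_products //; apply: eq_bigr => p.
  rewrite inE => /andP[pN _]; rewrite -prod_mono_cumulant.
  apply: eq_bigr => W Wp; rewrite map_comp (mixed_cumulants_vanish phi1 free_ab) //.
  by rewrite size_map -cardE card_gt0 (NCon_block_neq0 pN).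
rewrite (eq_bigr _ (fun T _ => wordE T)) exchange_big X2E //= mulr_sumr.
rewrite [RHS](eq_bigl (fun p => (p \in NCon_linked [set: 'I_n]) &&
  bipartite_graph (pair_graph p))) => [|p]; last by rewrite inE.
rewrite big_mkcondr; apply: eq_bigr => p; rewrite inE => /andP[pN lk].
rewrite -mulr_suml -natr_sum.
have -> : (\sum_(T : {set 'I_n}) monochromatic T p)%N = #|[set T | monochromatic T p]|.
  by rewrite -sum1dep_card [RHS]big_mkcond; apply: eq_bigr => T _; case: ifP.
rewrite card_monochromatic //; case: ifP => _; last by rewrite mul0r.
congr (_ * _); apply: eq_bigr => W Wp; rewrite lambda_a // card_gt0.
exact: NCon_block_neq0 pN Wp.
Qed.
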